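(* Let $\theta^\star\in\mathbb{R}^n$ be deterministic with $|\theta^\star_i|\le\mu$ for all $i\in[n]$, where $\mu\ge1$. Let $\pi$ be a uniformly random permutation of $[n]$, $\theta=(\theta^\star_{\pi(1)},\dots,\theta^\star_{\pi(n)})$, and conditionally on $\theta$ let $X\sim\mathcal N(\theta,I_n)$. Define $\widehat\theta^{\rm S}_i=\mathbb{E}[\theta_i\mid X_i]$ and $\widehat\theta^{\rm PI}_i=\mathbb{E}[\theta_i\mid X]$. Then $$\mathbb{E}\big[\|\widehat\theta^{\rm S}-\widehat\theta^{\rm PI}\|_2^2\big]\le\min\{C\mu\log^2 n,\;n\},$$ where $C<\infty$ is an absolute constant. *)

(* Defs.v *)
From HB Require Import structures.
From mathcomp Require Import all_boot all_order all_algebra all_fingroup.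
From mathcomp Require Import all_classical all_reals all_analysis.
Set Implicit Arguments. Unset Strict Implicit. Unset Printing Implicit Defensive.
Import Order.TTheory GRing.Theory Num.Theory.
Local Open Scope ring_scope.

Section Defs.
Variable R : realType.

(* Iterated Lebesgue integral over R^n of a function of x : nat -> R
   (only coordinates 0..n-1 are integrated; the others are fixed to 0).
   Coordinate n-1 is the outermost integration variable.  For nonnegative
   measurable integrands this is the Lebesgue integral over R^n (Tonelli). *)
Fixpoint iter_int (n : nat) (f : (nat -> R) -> \bar R) : \bar R :=
  match n with
  | 0 => f (fun _ => 0)
  | k.+1 => (\int[@lebesgue_measure R]_t
               iter_int k (fun x => f (fun j => if j == k then t else x j)))%E
  end.

Variable n : nat.
Variable ts : 'I_n -> R.

(* density of X given pi = s : X ~ N(theta, I_n) with theta_i = ts (s i) *)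
Definition dens (s : 'S_n) (x : nat -> R) : R :=
  \prod_(i < n) normal_pdf (ts (s i)) 1 (x i).

(* Bayes formula for E[theta_i | X_i], pi uniform on S_n *)
Definition thetaS (i : 'I_n) (x : nat -> R) : R :=
  (\sum_(s : 'S_n) ts (s i) * normal_pdf (ts (s i)) 1 (x i)) /
  (\sum_(s : 'S_n) normal_pdf (ts (s i)) 1 (x i)).

(* Bayes formula for E[theta_i | X], pi uniform on S_n *)
Definition thetaPI (i : 'I_n) (x : nat -> R) : R :=
  (\sum_(s : 'S_n) ts (s i) * dens s x) / (\sum_(s : 'S_n) dens s x).

Definition risk : \bar R :=
  ((n`!%:R)^-1)%:E *
  (\sum_(s : 'S_n)
     iter_int n (fun x => ((\sum_(i < n) (thetaS i x - thetaPI i x) ^+ 2)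
                           * dens s x)%:E))%E.

End Defs.

(* Main.v *)
Require Import Defs.
From HB Require Import structures.
From mathcomp Require Import all_boot all_order all_algebra all_fingroup.
From mathcomp Require Import all_classical all_reals all_analysis.
From mathcomp Require Import measurable_realfun ring lra.
Import Order.TTheory GRing.Theory Num.Theory.
Local Open Scope ring_scope.
Set Implicit Arguments. Unset Strict Implicit. Unset Printing Implicit Defensive.

(** Attach to each coordinate an unbiased random rounding [Y_i] of [theta_i] to
    one of the two nearest integers.  Let [P] be the law of [(X, Y)] and [Q] the product
    of its marginals.  Given [X], the means of [Y_i] under [P] and [Q] are
    [thetaPI_i] and [thetaS_i]; since the posterior of [theta_i] given a typical
    [X_i] is sub-Gaussian with variance proxy of order [log n], the
    Donsker-Varadhan inequality bounds the risk by [log n] times [KL(P || Q)].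
    By the chain rule for sampling without replacement, [KL(P || Q)] is at most
    [O(1) + T * (1 + 1/2 + ... + 1/n)], where
    [T = \int \sum_y (\sum_j K_j ^ 2) / (\sum_j K_j)] and [K_j(x, y)] is the
    density of [(X, Y)] given mean [ts j]; each of the [O(mu)] integers [y]
    contributes [O(1)] to [T], because only means within 1 of [y] can round to [y].

    All the inequalities are proved pointwise in [x] with a right-hand side that is
    a finite sum of products of functions of one coordinate, so that only
    one-dimensional integrals are ever computed. *)

(** * Iterated integrals without measurability *)

Section LowerIntegral.
Local Open Scope ereal_scope.
Context d (T : measurableType d) (R : realType).
Variable mu : {measure set T -> \bar R}.
Import HBNNSimple.

(* [ge0_le_integral] of the library requires measurability, which is not
   available for the inner iterated integrals of the risk. *)
Lemma ge0_le_integralT (f g : T -> \bar R) :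
  (forall x, 0 <= f x) -> (forall x, f x <= g x) ->
  \int[mu]_x f x <= \int[mu]_x g x.
Proof.
move=> f0 fg; have g0 x : 0 <= g x by apply: le_trans (fg x).
rewrite !ge0_integralTE//; apply: ereal_sup_le => _ [h hf <-].
by exists h => // x; apply: le_trans (fg x).
Qed.

(** Simple functions below [f] and [g] add up to a simple function below the sum. Without
    measurability only this half of additivity survives, and it is the half used for the risk. *)
Lemma ge0_integral_superadd (f g : T -> \bar R) :
  (forall x, 0 <= f x) -> (forall x, 0 <= g x) ->
  \int[mu]_x f x + \int[mu]_x g x <= \int[mu]_x (f x + g x).
Proof.
move=> f0 g0.
have fg0 x : 0 <= f x + g x by rewrite adde_ge0.
have [->|Iy] := eqVneq (\int[mu]_x (f x + g x)) +oo; first by rewrite leey.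
have Ifin : \int[mu]_x (f x + g x) \is a fin_num.
  by rewrite ge0_fin_numE ?integral_ge0// lt_neqAle Iy leey.
have If_fin : \int[mu]_x f x \is a fin_num.
  rewrite ge0_fin_numE ?integral_ge0//; apply: (@le_lt_trans _ _ (\int[mu]_x (f x + g x))).
    by apply: ge0_le_integralT => // x; rewrite leeDl.
  by rewrite lt_neqAle Iy leey.
rewrite addeC -leeBrDr// [X in X <= _]ge0_integralTE//.
apply: ge_ereal_sup => _ [k /= kg <-].
have kfin : sintegral mu k \is a fin_num.
  rewrite ge0_fin_numE ?sintegral_ge0//.
  apply: (@le_lt_trans _ _ (\int[mu]_x (f x + g x))).
    rewrite ge0_integralTE//; apply: ereal_sup_ubound; exists k => // x /=.
    by rewrite (le_trans (kg x))// leeDr.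
  by rewrite lt_neqAle Iy leey.
rewrite leeBrDr// addeC -leeBrDr// [X in X <= _]ge0_integralTE//.
apply: ge_ereal_sup => _ [h /= hf <-].
rewrite leeBrDr// -sintegralD// ge0_integralTE//.
apply: ereal_sup_ubound; exists (add_nnsfun h k) => // x /=.
by rewrite EFinD leeD.
Qed.

End LowerIntegral.

Section IterInt.
Variable R : realType.
Local Notation leb := (@lebesgue_measure R).
Implicit Types (n : nat) (f g : (nat -> R) -> \bar R).

Lemma iter_int_ge0 n f : (forall x, 0 <= f x)%E -> (0 <= iter_int n f)%E.
Proof.
elim: n f => [|n IH] f f0 //=.
by apply: integral_ge0 => t _; apply: IH.
Qed.

Lemma le_iter_int n f g : (forall x, 0 <= f x)%E -> (forall x, f x <= g x)%E ->
  (iter_int n f <= iter_int n g)%E.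
Proof.
elim: n f g => [|n IH] f g f0 fg //=.
by apply: ge0_le_integralT => t; [apply: iter_int_ge0|apply: IH].
Qed.

Lemma iter_int_superadd n f g : (forall x, 0 <= f x)%E -> (forall x, 0 <= g x)%E ->
  (iter_int n f + iter_int n g <= iter_int n (fun x => f x + g x))%E.
Proof.
elim: n f g => [|n IH] f g f0 g0 //=.
apply: (le_trans (ge0_integral_superadd _ _ _)).
- by move=> t; apply: iter_int_ge0.
- by move=> t; apply: iter_int_ge0.
apply: ge0_le_integralT => t; last exact: IH.
by rewrite adde_ge0//; apply: iter_int_ge0.
Qed.

Lemma iter_int_superadd_sum (I : Type) (r : seq I) n (f : I -> (nat -> R) -> \bar R) :
  (forall i x, 0 <= f i x)%E ->
  (\sum_(i <- r) iter_int n (f i) <= iter_int n (fun x => \sum_(i <- r) f i x))%E.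
Proof.
move=> f0; elim: r => [|i r IH].
  rewrite big_nil; apply: iter_int_ge0 => x; by rewrite big_nil.
have -> : (fun x => \sum_(j <- i :: r) f j x)%E = (fun x => f i x + \sum_(j <- r) f j x)%E.
  by apply/funext => x; rewrite big_cons.
rewrite big_cons.
apply: le_trans (iter_int_superadd _ _ _) => //; first exact: leeD.
by move=> x; apply: sume_ge0.
Qed.

Lemma iter_int_sum_prod (K : Type) (r : seq K) n (g : K -> nat -> R -> R) (J : K -> nat -> R) (c : K -> R) :
  (forall k, 0 <= c k) ->
  (forall k i, measurable_fun setT (g k i)) -> (forall k i x, 0 <= g k i x) ->
  (forall k i, (i < n)%N -> (\int[leb]_x (g k i x)%:E = (J k i)%:E)%E) ->
  iter_int n (fun x => (\sum_(k <- r) c k * \prod_(i < n) g k i (x i))%:E)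
  = (\sum_(k <- r) c k * \prod_(i < n) J k i)%:E.
Proof.
move=> c0 mg g0.
have J0 m k : (\int[leb]_x (g k m x)%:E = (J k m)%:E)%E -> 0 <= J k m.
  by move=> e; rewrite -lee_fin -e; apply: integral_ge0 => x _; rewrite lee_fin.
(* [c] is generalized because freezing the outermost variable at [t] turns [c k] into
   [c k * g k n t]. *)
move: c0; elim: n c => [|n IH] c c0 gJ /=.
  by congr EFin; apply: eq_bigr => k _; rewrite !big_ord0.
have gJ' k i : (i < n)%N -> (\int[leb]_x (g k i x)%:E = (J k i)%:E)%E.
  by move=> ilt; apply: gJ; rewrite ltnW.
have Jn0 k : 0 <= \prod_(i < n) J k i.
  by apply: prodr_ge0 => i _; apply: J0; apply: gJ'.
transitivity (\int[leb]_t (\sum_(k <- r) (c k * \prod_(i < n) J k i)%:E * (g k n t)%:E))%E.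
  apply: eq_integral => t _.
  transitivity (iter_int n (fun x => (\sum_(k <- r) (c k * g k n t) * \prod_(i < n) g k i (x i))%:E)).
    congr iter_int; apply/funext => x; congr EFin; apply: eq_bigr => k _.
    rewrite big_ord_recr /= eqxx -[RHS]mulrA [g k n t * _]mulrC.
    by congr (_ * (_ * _)); apply: eq_bigr => i _; rewrite ltn_eqF.
  rewrite IH//; last by move=> k; rewrite mulr_ge0.
  by rewrite -sumEFin; apply: eq_bigr => k _; rewrite -EFinM mulrAC.
rewrite ge0_integral_sum//.
- rewrite -sumEFin; apply: eq_bigr => k _.
  rewrite ge0_integralZl//.
  + by rewrite gJ// big_ord_recr/= mulrA.
  + by apply/measurable_EFinP; exact: mg.
  + by move=> x _; rewrite lee_fin.
  + by rewrite lee_fin mulr_ge0.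
- move=> k; apply: measurable_funeM; apply/measurable_EFinP; exact: mg.
- by move=> k x _; rewrite mule_ge0// lee_fin// mulr_ge0.
Qed.

End IterInt.

(** * Sampling without replacement *)

Section PlackettLuce.
Variable R : realType.

(** Separates the first draw from the order of the remaining ones; injectivity suffices since both
    sides have (n + 1)! elements. *)
Lemma lift_perm_pair_bij n :
  bijective (fun p : 'I_n.+1 * 'S_n => lift_perm ord0 p.1 p.2).
Proof.
apply: inj_card_bij; last by rewrite card_prod !card_Sn card_ord factS.
move=> [j s] [j' s'] /= e.
have ej : j = j' by have := congr1 (fun t : 'S_n.+1 => t ord0) e; rewrite !lift_perm_id.
rewrite -ej in e *; congr (_, _); apply/permP => i.
have := congr1 (fun t : 'S_n.+1 => t (lift ord0 i)) e.
by rewrite !lift_perm_lift => /lift_inj.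
Qed.

(* The summand is the probability of [s] when the indices [s 0, s 1, ...] are
   drawn successively without replacement, the [i]-th with weights [k _ i]
   (the sum is less than 1 only if some 0 / 0 = 0 occurs). *)
Lemma plackett_luce_le1 n (k : 'I_n -> 'I_n -> R) : (forall j i, 0 <= k j i) ->
  \sum_(s : 'S_n) \prod_i (k (s i) i / \sum_(l < n | (i <= l)%N) k (s l) i) <= 1.
Proof.
elim: n k => [|n IH] k k0.
  under eq_bigr do rewrite big_ord0.
  by rewrite sumr_const -[X in _ *+ X]/#|'S_0| card_Sn.
rewrite (reindex (fun p : 'I_n.+1 * 'S_n => lift_perm ord0 p.1 p.2)) /=; last first.
  exact: onW_bij (lift_perm_pair_bij n).
rewrite -(pair_bigA _ (fun j s => \prod_i (k (lift_perm ord0 j s i) i /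
  \sum_(l < n.+1 | (i <= l)%N) k (lift_perm ord0 j s l) i))) /=.
(* The denominator of the first draw, common to all permutations because they only reorder its
   terms. *)
pose S := \sum_j k j ord0.
apply: (@le_trans _ _ (\sum_j k j ord0 / S)); last first.
  rewrite -mulr_suml -/S.
  by have [->|S0] := eqVneq S 0; [rewrite mul0r ler01|rewrite divff].
apply: ler_sum => j _.
have -> : \sum_(s : 'S_n) \prod_i (k (lift_perm ord0 j s i) i /
    \sum_(l < n.+1 | (i <= l)%N) k (lift_perm ord0 j s l) i) =
  k j ord0 / S * \sum_(s : 'S_n) \prod_i (k (lift j (s i)) (lift ord0 i) /
     \sum_(l < n | (i <= l)%N) k (lift j (s l)) (lift ord0 i)).
  rewrite mulr_sumr; apply: eq_bigr => s _.
  rewrite big_ord_recl lift_perm_id; congr (_ / _ * _).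
    by rewrite /S [RHS](reindex_inj (@perm_inj _ (lift_perm ord0 j s))); apply: eq_bigl.
  apply: eq_bigr => i _; rewrite lift_perm_lift; congr (_ / _).
  rewrite big_mkcond big_ord_recl /= add0r [RHS]big_mkcond.
  by apply: eq_bigr => l _; rewrite lift_perm_lift.
rewrite ler_piMr ?divr_ge0 ?sumr_ge0//.
exact: (IH (fun a b => k (lift j a) (lift ord0 b))).
Qed.

(** Combine [t i <= expR (t i - 1)] for each factor with [1 + z <= expR z]. This replaces the
    logarithms of a relative entropy. *)
Lemma expR_prod_ratio n (F : R) (t : 'I_n -> R) : (forall i, 0 < t i) ->
  F + n%:R <= expR F * \prod_i (t i)^-1 + \sum_i t i.
Proof.
move=> t0.
have : 1 + (F - \sum_i (t i - 1)) <= expR F * \prod_i (t i)^-1.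
  apply: le_trans (expR_ge1Dx _) _.
  rewrite expRD ler_wpM2l ?expR_ge0// expRN expR_sum -prodfV.
  apply: ler_prod => i _; rewrite invr_ge0 expR_ge0 /=.
  by rewrite lef_pV2 ?posrE ?expR_gt0//; have := expR_ge1Dx (t i - 1); rewrite addrC subrK.
rewrite sumrB sumr_const card_ord.
set A := \sum_i _; set B := _ * _; set m := _%:R; lra.
Qed.

Definition remsum n (k : 'I_n -> 'I_n -> R) (s : 'S_n) (i : 'I_n) : R :=
  \sum_(l < n | (i <= l)%N) k (s l) i.

(* A pointwise form of [KL(P || Q) + Donsker-Varadhan], with test function [F]:
   [k j i] is the density at the [i]-th observation of the [j]-th law, and the
   ratio in the last sum compares the average law of the indices not yet drawn
   to the average of all the laws. *)
Lemma perm_decoupling n (k : 'I_n -> 'I_n -> R) (F : R) :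
  (forall j i, 0 <= k j i) ->
  \sum_(s : 'S_n) (\prod_i k (s i) i) * (F + n%:R) <=
  n`!%:R * expR F * \prod_i ((\sum_j k j i) / n%:R) +
  \sum_(s : 'S_n) (\prod_i k (s i) i) *
    \sum_i ((remsum k s i / (n - i)%:R) / ((\sum_j k j i) / n%:R)).
Proof.
move=> k0.
have rem0 s i : 0 <= remsum k s i by apply: sumr_ge0.
(* The first term is spread over the permutations with the weights of [plackett_luce_le1]; it
   remains to argue for each [s]. *)
apply: (@le_trans _ _ (\sum_(s : 'S_n) ((n`!%:R * expR F * \prod_i ((\sum_j k j i) / n%:R)) *
   \prod_i (k (s i) i / remsum k s i) + (\prod_i k (s i) i) *
    \sum_i ((remsum k s i / (n - i)%:R) / ((\sum_j k j i) / n%:R))))); last first.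
  rewrite big_split /= lerD2r -mulr_sumr ler_piMr ?plackett_luce_le1//.
  by rewrite !mulr_ge0 ?expR_ge0// prodr_ge0// => i _; rewrite divr_ge0 ?sumr_ge0.
apply: ler_sum => s _.
have [kp|] := boolP [forall i, 0 < k (s i) i]; last first.
  rewrite negb_forall => /existsP[i]; rewrite -leNgt => ki.
  have k_0 : k (s i) i = 0 by apply/le_anti; rewrite ki k0.
  have -> : \prod_i k (s i) i = 0 by rewrite (bigD1 i)//= k_0 mul0r.
  by rewrite [X in _ * X + _](bigD1 i)//= k_0 !mul0r mulr0 add0r.
move/forallP: kp => kp.
have remp i : 0 < remsum k s i.
  by rewrite /remsum (bigD1 i)//= ltr_wpDr// sumr_ge0.
have np (i : 'I_n) : (0 < (n - i)%:R :> R) by rewrite ltr0n subn_gt0 ltn_ord.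
have np' (i : 'I_n) : (0 < n%:R :> R) by rewrite ltr0n (leq_trans _ (ltn_ord i)).
have fp i : 0 < \sum_j k j i by rewrite (bigD1 (s i))//= ltr_wpDr// sumr_ge0.
have := @expR_prod_ratio n F (fun i => (remsum k s i / (n - i)%:R) / ((\sum_j k j i) / n%:R)) _.
have kp0 : 0 <= \prod_i k (s i) i by apply: prodr_ge0.
move=> /(_ (fun i => divr_gt0 (divr_gt0 (remp i) (np i)) (divr_gt0 (fp i) (np' i)))).
move=> /(ler_wpM2l kp0) /le_trans; apply.
rewrite mulrDr lerD2r le_eqVlt; apply/orP; left; apply/eqP.
(* The factors [n - i] of n! cancel the normalizations of the remaining sums, which leaves the
   Plackett-Luce product. *)
have -> : n`!%:R = \prod_(i < n) (n - i)%:R :> R.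
  by rewrite -natr_prod -ffactnn ffact_prod.
rewrite mulrCA -!mulrA [RHS]mulrCA; congr (_ * _).
rewrite -!big_split /=; apply: eq_bigr => i _.
move: (np i) (np' i) (remp i) (fp i); move: (n - i)%:R n%:R (remsum k s i) (\sum_j k j i) => a b c e a0 b0 c0 e0.
by field; rewrite !gt_eqF.
Qed.

End PlackettLuce.

(** * Averages over a uniform permutation *)

Section PermAverage.
Variable R : realType.

(** Composing with transpositions shows that the sum over [s] is the same for every position; adding
    up the positions exhausts all indices. *)
Lemma sum_perm1 n (D : 'I_n -> R) (i : 'I_n) :
  n%:R * \sum_(s : 'S_n) D (s i) = n`!%:R * \sum_j D j.
Proof.
transitivity (\sum_(l < n) \sum_(s : 'S_n) D (s l)).
  rewrite -[n in n%:R]card_ord -sum1_card natr_sum mulr_suml; apply: eq_bigr => l _.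
  rewrite mul1r (reindex_inj (mulgI (tperm i l))) /=.
  by apply: eq_bigr => s _; rewrite permM tpermL.
rewrite exchange_big /= -[in RHS]card_Sn -sum1_card natr_sum mulr_suml.
by apply: eq_bigr => s _; rewrite mul1r [RHS](reindex_inj (@perm_inj _ s)).
Qed.

(** All second positions other than [i] give the same sum; adding them up yields row sums of [B]
    without the diagonal entry. *)
Lemma sum_perm2_le n (B : 'I_n -> 'I_n -> R) (c : R) (i l : 'I_n) :
  (forall j k, 0 <= B j k) -> (forall j, \sum_k B j k = c) -> l != i ->
  (n.-1)%:R * \sum_(s : 'S_n) B (s i) (s l) <= n`!%:R * c.
Proof.
move=> B0 Bc il.
have -> : (n.-1)%:R * \sum_(s : 'S_n) B (s i) (s l) =
   \sum_(l' < n | l' != i) \sum_(s : 'S_n) B (s i) (s l').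
  have -> : n.-1 = #|predC1 i| by rewrite cardC1 card_ord.
  rewrite -sum1_card natr_sum mulr_suml; apply: eq_bigr => l' l'i.
  rewrite mul1r (reindex_inj (mulgI (tperm l l'))) /=.
  by apply: eq_bigr => s _; rewrite !permM tpermL tpermD// eq_sym.
rewrite exchange_big /= -[in leRHS]card_Sn -sum1_card natr_sum mulr_suml.
apply: ler_sum => s _; rewrite mul1r -(Bc (s i)).
rewrite [leRHS](reindex_inj (@perm_inj _ s)) /=.
by rewrite [leRHS](bigD1 i)//= lerDr.
Qed.

End PermAverage.

(** * Sub-Gaussian bounds from exponential square moments *)

Section SubGaussian.
Variable R : realType.
Implicit Types t a u : R.

(** For [t <= 1], squaring [1 - t / 2 <= expR (- t / 2)] bounds [expR t] by [(1 - t / 2) ^- 2],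
    which is at most [1 + t + 2 * t ^+ 2]. *)
Lemma expR_le_id_expR_sqr t : expR t <= t + expR (2 * t ^+ 2).
Proof.
have [t1|t1] := lerP t 1; last first.
  apply: (@le_trans _ _ (expR (2 * t ^+ 2))); last by rewrite lerDr; lra.
  by rewrite ler_expR; nra.
have e1 : expR (- t / 2) >= 1 - t / 2 by have := expR_ge1Dx (- t / 2); lra.
have e2 : expR t * expR (- t / 2) ^+ 2 = 1.
  by rewrite expr2 -!expRD -[RHS]expR0; congr expR; lra.
have e3 : 1 + 2 * t ^+ 2 <= expR (2 * t ^+ 2) by exact: expR_ge1Dx.
have e4 : (1 - t / 2) ^+ 2 <= expR (- t / 2) ^+ 2.
  by rewrite ler_sqr// nnegrE ?expR_ge0//; lra.
have e5 : expR t * (1 - t / 2) ^+ 2 <= 1.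
  by rewrite -[leRHS]e2; apply: ler_wpM2l e4; exact: expR_ge0.
have q0 : 0 < (1 - t / 2) ^+ 2 by rewrite exprn_gt0//; lra.
have : expR t <= 1 + t + 2 * t ^+ 2; last by lra.
rewrite -(ler_pM2r q0); apply: (le_trans e5).
(* This is twice [(1 + t + 2 * t ^+ 2) * (1 - t / 2) ^+ 2 - 1]. *)
have : 0 <= t ^+ 2 * ((1 - t) * (5 / 2 - t)) by rewrite mulr_ge0 ?sqr_ge0// mulr_ge0; lra.
by nra.
Qed.

Lemma expR_convex0 a u : 0 <= a -> a <= 1 -> expR (a * u) <= 1 - a + a * expR u.
Proof.
move=> a0 a1.
have h (y : R) : expR (a * u) * (1 + (y - a * u)) <= expR y.
  have -> : expR y = expR (a * u) * expR (y - a * u) by rewrite -expRD addrC subrK.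
  by rewrite ler_wpM2l ?expR_ge0// expR_ge1Dx.
have h1 := ler_wpM2l a0 (h u).
have a1' : 0 <= 1 - a by lra.
have h0 := ler_wpM2l a1' (h 0); rewrite expR0 in h0.
have := lerD h0 h1; rewrite mulr1.
by set E := expR (a * u); have -> : (1 - a) * (E * (1 + (0 - a * u))) + a * (E * (1 + (u - a * u))) = E by ring.
Qed.

(** Let [a = 2 * v * lam ^+ 2]. If [a <= 1], [expR_le_id_expR_sqr] produces a linear term, which has
    mean 0, and a square term handled by convexity. If [a > 1], use
    [lam * Z i <= Z i ^+ 2 / v + a / 8] and absorb [M] into [expR ((M - 1) * a)]. *)
Lemma subgaussian_mgf (I : finType) (w Z : I -> R) (v M lam : R) :
  (forall i, 0 <= w i) -> 0 < v -> 1 <= M -> \sum_i w i * Z i = 0 ->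
  \sum_i w i * expR (Z i ^+ 2 / v) <= M * \sum_i w i ->
  \sum_i w i * expR (lam * Z i) <= expR (2 * M * v * lam ^+ 2) * \sum_i w i.
Proof.
move=> w0 v0 M1 wZ wM; set W := \sum_i w i in wM *.
have W0 : 0 <= W by apply: sumr_ge0.
pose a := 2 * v * lam ^+ 2.
have a0 : 0 <= a by rewrite /a mulr_ge0 ?sqr_ge0// mulr_ge0// ltW.
have -> : 2 * M * v * lam ^+ 2 = M * a by rewrite /a; ring.
have [a1|a1] := lerP a 1.
- apply: (@le_trans _ _ (lam * \sum_i w i * Z i + ((1 - a) * W + a * (M * W)))).
    rewrite mulr_sumr /W mulr_sumr.
    apply: (@le_trans _ _ (\sum_i (lam * (w i * Z i) + ((1 - a) * w i + a * (w i * expR (Z i ^+ 2 / v)))))).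
      apply: ler_sum => i _.
      have := expR_le_id_expR_sqr (lam * Z i).
      have -> : 2 * (lam * Z i) ^+ 2 = a * (Z i ^+ 2 / v).
        by rewrite /a; field; rewrite gt_eqF.
      have := expR_convex0 (Z i ^+ 2 / v) a0 a1.
      set e1 := expR (a * _); set e2 := expR (_ / _); set e3 := expR _ => h1 h2.
      have := ler_wpM2l (w0 i) (le_trans h2 (lerD (lexx (lam * Z i)) h1)).
      by lra.
    by rewrite !big_split /= lerD2l lerD2l -mulr_sumr ler_wpM2l.
  rewrite wZ mulr0 add0r.
  have := expR_ge1Dx (M * a) => /(ler_wpM2r W0); nra.
- have hM : M <= expR ((M - 1) * a).
    have := expR_ge1Dx ((M - 1) * a); nra.
  apply: (@le_trans _ _ (expR (a / 8) * (M * W))).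
    apply: le_trans (ler_wpM2l (expR_ge0 _) wM); rewrite mulr_sumr.
    apply: ler_sum => i _; rewrite mulrCA ler_wpM2l// -expRD ler_expR.
    have : 0 <= (Z i - lam * v / 2) ^+ 2 / v by rewrite divr_ge0 ?sqr_ge0// ltW.
    have -> : (Z i - lam * v / 2) ^+ 2 / v = Z i ^+ 2 / v + a / 8 - lam * Z i.
      by rewrite /a; field; rewrite gt_eqF.
    lra.
  rewrite mulrA ler_wpM2r//.
  apply: le_trans (ler_wpM2l (expR_ge0 _) hM) _; rewrite -expRD ler_expR; lra.
Qed.

End SubGaussian.

(** * Finite sums of products of one-variable functions *)

Section ProdSum.
Variable R : realType.
Local Notation leb := (@lebesgue_measure R).

(** Here [v] is the iterated integral of [f]; carrying it in the predicate builds a decomposition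
    and its integral together. *)
Definition prodsum n (f : (nat -> R) -> R) (v : R) : Prop :=
  exists (K : finType) (c : K -> R) (g : K -> 'I_n -> R -> R) (J : K -> 'I_n -> R),
  [/\ forall k, 0 <= c k,
      forall k i, measurable_fun setT (g k i),
      forall k i x, 0 <= g k i x &
      forall k i, (\int[leb]_x (g k i x)%:E = (J k i)%:E)%E] /\
  (forall x, f x = \sum_k c k * \prod_i g k i (x i)) /\
  v = \sum_k c k * \prod_i J k i.

Lemma prodsum_iter_int n f v : prodsum n f v ->
  iter_int n (fun x => (f x)%:E) = v%:E.
Proof.
move=> [K [c [g [J [[c0 mg g0 gJ] [fE ->]]]]]].
pose g' k (i : nat) : R -> R := if insub i is Some j then g k j else cst 0.
pose J' k (i : nat) : R := if insub i is Some j then J k j else 0.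
have -> : (fun x => (f x)%:E) =
    (fun x => (\sum_(k <- index_enum K) c k * \prod_(i < n) g' k i (x i))%:E).
  apply/funext => x; rewrite fE; congr EFin; apply: eq_bigr => k _; congr (_ * _).
  by apply: eq_bigr => i _; rewrite /g' valK.
rewrite (@iter_int_sum_prod R K _ n g' J')//.
- congr EFin; apply: eq_bigr => k _; congr (_ * _).
  by apply: eq_bigr => i _; rewrite /J' valK.
- by move=> k i; rewrite /g'; case: insub => [j|//]; apply: mg.
- by move=> k i x; rewrite /g'; case: insub => [j|//]; apply: g0.
- by move=> k i ilt; rewrite /g' /J' insubT; apply: gJ.
Qed.

Lemma prodsum_ge0 n f v : prodsum n f v -> forall x, 0 <= f x.
Proof.
move=> [K [c [g [J [[c0 mg g0 gJ] [fE _]]]]]] x.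
by rewrite fE sumr_ge0// => k _; rewrite mulr_ge0// prodr_ge0.
Qed.

Lemma prodsum_ext n f f' v v' : prodsum n f v -> f =1 f' -> v = v' -> prodsum n f' v'.
Proof. by move=> p /funext ef ev; rewrite -ef -ev. Qed.

Lemma prodsumD n f1 f2 v1 v2 : prodsum n f1 v1 -> prodsum n f2 v2 ->
  prodsum n (fun x => f1 x + f2 x) (v1 + v2).
Proof.
move=> [K1 [c1 [g1 [J1 [[? ? ? ?] [f1E ->]]]]]] [K2 [c2 [g2 [J2 [[? ? ? ?] [f2E ->]]]]]].
exists (K1 + K2)%type, (fun k => match k with inl a => c1 a | inr a => c2 a end),
  (fun k => match k with inl a => g1 a | inr a => g2 a end),
  (fun k => match k with inl a => J1 a | inr a => J2 a end).
split; first by split; case.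
by split=> [x|]; rewrite big_sumType // f1E f2E.
Qed.

Lemma prodsumZ n (a : R) f v : 0 <= a -> prodsum n f v ->
  prodsum n (fun x => a * f x) (a * v).
Proof.
move=> a0 [K [c [g [J [[c0 ? ? ?] [fE ->]]]]]].
exists K, (fun k => a * c k), g, J; split; first by split=> // k; rewrite mulr_ge0.
by split=> [x|]; rewrite ?fE mulr_sumr; apply: eq_bigr => k _; rewrite mulrA.
Qed.

Lemma prodsum0 n : prodsum n (fun=> 0) 0.
Proof.
exists void, (fun=> 0), (fun=> fun=> fun=> 0), (fun=> fun=> 0); split; first by split; case.
by split=> [x|]; rewrite big1// => -[].
Qed.

Lemma prodsum_sum n (I : Type) (r : seq I) (P : pred I) (f : I -> (nat -> R) -> R) (v : I -> R) :
  (forall i, P i -> prodsum n (f i) (v i)) ->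
  prodsum n (fun x => \sum_(i <- r | P i) f i x) (\sum_(i <- r | P i) v i).
Proof.
move=> H; elim: r => [|i r IH].
  by apply: prodsum_ext (prodsum0 n) _ _ => [x|]; rewrite big_nil.
have [Pi|Pi] := boolP (P i).
  by apply: prodsum_ext (prodsumD (H i Pi) IH) _ _ => [x|]; rewrite big_cons Pi.
by apply: prodsum_ext IH _ _ => [x|]; rewrite big_cons (negbTE Pi).
Qed.

Lemma prodsum_prod n (g : 'I_n -> R -> R) (J : 'I_n -> R) :
  (forall i, measurable_fun setT (g i)) -> (forall i x, 0 <= g i x) ->
  (forall i, (\int[leb]_x (g i x)%:E = (J i)%:E)%E) ->
  prodsum n (fun x => \prod_i g i (x i)) (\prod_i J i).
Proof.
move=> mg g0 gJ; exists unit, (fun=> 1), (fun=> g), (fun=> J); split; first by split.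
by split=> [x|]; rewrite (big_pred1 tt) ?mul1r//; case.
Qed.

Lemma prodsum_normal_mod n (m : 'I_n -> R) (i : 'I_n) (u : R -> R) (J : R) :
  measurable_fun setT u -> (forall x, 0 <= u x) ->
  (\int[leb]_x (u x)%:E = J%:E)%E ->
  prodsum n (fun x => (\prod_(l < n | l != i) normal_pdf (m l) 1 (x l)) * u (x i)) J.
Proof.
move=> mu u0 uJ.
apply: (@prodsum_ext _ _ _ _ _ (@prodsum_prod n (fun l => if l == i then u else normal_pdf (m l) 1)
  (fun l => if l == i then J else 1) _ _ _)).
- by move=> l; case: ifP => _ //; apply: measurable_normal_pdf.
- by move=> l x; case: ifP => _ //; apply: normal_pdf_ge0.
- by move=> l; case: ifP => _ //; rewrite integral_normal_pdf.
- move=> x; rewrite (bigD1 i)//= eqxx mulrC; congr (_ * _).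
  by apply: eq_bigr => l /negbTE ->.
- by rewrite (bigD1 i)//= eqxx big1 ?mulr1// => l /negbTE ->.
Qed.

Lemma prodsum_normal n (m : 'I_n -> R) :
  prodsum n (fun x => \prod_(l < n) normal_pdf (m l) 1 (x l)) 1.
Proof.
apply: prodsum_ext (@prodsum_prod n (fun l => normal_pdf (m l) 1) (fun=> 1) _ _ _) _ _ => //.
- by move=> l; apply: measurable_normal_pdf.
- by move=> l x; apply: normal_pdf_ge0.
- by move=> l; rewrite integral_normal_pdf.
- by rewrite big1.
Qed.

(** Keeping [g1] on the left avoids integrating a difference: superadditivity applies to [f + g1]
    although [f] is not assumed measurable. *)
Lemma iter_int_le_prodsum n (f g1 g2 : (nat -> R) -> R) v1 v2 :
  (forall x, 0 <= f x) -> prodsum n g1 v1 -> prodsum n g2 v2 ->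
  (forall x, f x + g1 x <= g2 x) -> (iter_int n (fun x => (f x)%:E) <= (v2 - v1)%:E)%E.
Proof.
move=> f0 p1 p2 fg; rewrite EFinB leeBrDr// -(prodsum_iter_int p1) -(prodsum_iter_int p2).
apply: le_trans (iter_int_superadd _ _ _) _ => [x|x|].
- by rewrite lee_fin.
- by rewrite lee_fin (prodsum_ge0 p1).
apply: le_iter_int => x; last by rewrite -EFinD lee_fin.
by rewrite -EFinD lee_fin addr_ge0// (prodsum_ge0 p1).
Qed.

End ProdSum.

(** * Weighted means and one-dimensional Gaussian integrals *)

Section Gaussian.
Variable R : realType.
Local Notation leb := (@lebesgue_measure R).

(** The cross term vanishes because [p] is the weighted mean. The identity serves as Jensen, as
    minimality of the mean and, with unit weights, as Cauchy-Schwarz. *)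
Lemma weighted_sqr_dev (I : finType) (w t : I -> R) (a : R) :
  \sum_i w i != 0 ->
  let p := (\sum_i t i * w i) / (\sum_i w i) in
  \sum_i w i * (t i - a) ^+ 2 =
  \sum_i w i * (t i - p) ^+ 2 + (\sum_i w i) * (p - a) ^+ 2.
Proof.
move=> W0 p; set W := \sum_i w i in W0 p *.
have pW : p * W = \sum_i t i * w i by rewrite /p divfK.
transitivity (\sum_i (w i * (t i - p) ^+ 2 + (2 * (p - a)) * (t i * w i) +
  (- (2 * (p - a)) * p + (p - a) ^+ 2) * w i)).
  by apply: eq_bigr => i _; ring.
by rewrite !big_split /= -!mulr_sumr -pW -/W; ring.
Qed.

Lemma normal_pdf1E (m x : R) :
  normal_pdf m 1 x = normal_peak 1 * expR (- (x - m) ^+ 2 / 2).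
Proof. by rewrite normal_pdfE ?oner_neq0// /normal_fun expr1n. Qed.

Lemma normal_pdf1_gt0 (m x : R) : 0 < normal_pdf m 1 x.
Proof. by rewrite normal_pdf1E mulr_gt0 ?expR_gt0 ?normal_peak_gt0. Qed.

Lemma normal_peak_scale (s : R) : 0 < s -> normal_peak 1 = s * normal_peak s.
Proof.
move=> s0; rewrite /normal_peak expr1n mul1r -mulrnAr sqrtrM ?sqr_ge0//.
by rewrite sqrtr_sqr gtr0_norm// invfM mulrA divff ?mul1r// gt_eqF.
Qed.

Lemma normal_pdf_scale (s m x : R) : 0 < s ->
  normal_peak 1 * expR (- (x - m) ^+ 2 / (s ^+ 2 *+ 2)) = s * normal_pdf m s x.
Proof.
move=> s0; rewrite normal_pdfE ?gt_eqF// /normal_fun mulrA -normal_peak_scale//.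
Qed.

Lemma measurable_inv_ge0 (f : R -> R) : (forall x, 0 <= f x) ->
  measurable_fun setT f -> measurable_fun setT (fun x => (f x)^-1).
Proof.
move=> f0 mf.
have -> : (fun x => (f x)^-1) = (fun y => y `^ (-1)) \o f.
  by apply/funext => x /=; rewrite powR_inv1.
by apply: measurableT_comp mf; apply: measurable_powR.
Qed.

Lemma integral_fin_real (u : R -> R) (c : R) : (forall x, 0 <= u x) ->
  (\int[leb]_x (u x)%:E <= c%:E)%E ->
  (\int[leb]_x (u x)%:E = (fine (\int[leb]_x (u x)%:E))%:E)%E /\
  0 <= fine (\int[leb]_x (u x)%:E).
Proof.
move=> u0 uc.
have i0 : (0 <= \int[leb]_x (u x)%:E)%E by apply: integral_ge0 => x _; rewrite lee_fin.
rewrite fineK ?fine_ge0//.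
by rewrite ge0_fin_numE//; apply: le_lt_trans uc _; rewrite ltry.
Qed.

(* Obtained by comparing the normal densities of variances [1] and [s ^ 2] as [s]
   decreases to 1. *)
Lemma integral_normal_sqr_le1 (m : R) :
  (\int[leb]_x (normal_pdf m 1 x * (m - x) ^+ 2)%:E <= 1)%E.
Proof.
have mu2 : measurable_fun setT (fun x : R => normal_pdf m 1 x * (m - x) ^+ 2).
  apply: measurable_funM; first exact: measurable_normal_pdf.
  by apply: measurable_funX; apply: measurable_funB.
have u20 (x : R) : 0 <= normal_pdf m 1 x * (m - x) ^+ 2.
  by rewrite mulr_ge0 ?normal_pdf_ge0 ?sqr_ge0.
have main (s : R) : 1 < s -> (\int[leb]_x (normal_pdf m 1 x * (m - x) ^+ 2)%:E <= (s ^+ 2)%:E)%E.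
  move=> s1; have s0 : 0 < s by lra.
  (* The ratio of the two exponentials is [expR (k * (m - x) ^+ 2)], which is at least
     [1 + k * (m - x) ^+ 2]. *)
  pose k := (1 - s ^- 2) / 2.
  have s2 : s ^- 2 < 1 by rewrite invf_lt1 ?exprn_gt0// exprn_egt1.
  have k0 : 0 < k by rewrite /k; lra.
  have : (\int[leb]_x ((normal_pdf m 1 x)%:E + k%:E * (normal_pdf m 1 x * (m - x) ^+ 2)%:E) <=
    \int[leb]_x (s%:E * (normal_pdf m s x)%:E))%E.
    apply: ge0_le_integralT => x.
      by rewrite adde_ge0 ?lee_fin ?normal_pdf_ge0// mulr_ge0// ltW.
    rewrite -!EFinM -EFinD lee_fin -normal_pdf_scale// normal_pdf1E.
    have := expR_ge1Dx (k * (m - x) ^+ 2).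
    have -> : - (x - m) ^+ 2 / (s ^+ 2 *+ 2) = - (x - m) ^+ 2 / 2 + k * (m - x) ^+ 2.
      by rewrite /k -mulr_natr; field; rewrite gt_eqF.
    rewrite expRD; set e := expR (_ / 2) => h.
    have h' : 0 <= normal_peak 1 * e by rewrite mulr_ge0 ?expR_ge0 ?normal_peak_ge0.
    have := ler_wpM2l h' h; lra.
  rewrite ge0_integralD//; last 4 first.
  - by move=> x _; rewrite lee_fin normal_pdf_ge0.
  - by apply/measurable_EFinP; apply: measurable_normal_pdf.
  - by move=> x _; rewrite -EFinM lee_fin mulr_ge0// ltW.
  - by apply: measurable_funeM; apply/measurable_EFinP.
  have Z (c : R) (u : R -> R) : 0 <= c -> measurable_fun setT u -> (forall x, 0 <= u x) ->
      (\int[leb]_x (c%:E * (u x)%:E) = c%:E * \int[leb]_x (u x)%:E)%E.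
    move=> c0 mu u0; rewrite ge0_integralZl//.
    - by apply/measurable_EFinP.
    - by move=> x _; rewrite lee_fin.
  rewrite (Z _ _ (ltW k0) mu2 u20) (Z _ _ (ltW s0) (@measurable_normal_pdf _ m s) (@normal_pdf_ge0 _ m s)).
  rewrite !integral_normal_pdf mule1.
  have : (0 <= \int[leb]_x (normal_pdf m 1 x * (m - x) ^+ 2)%:E)%E.
    by apply: integral_ge0 => x _; rewrite lee_fin.
  case: (\int[leb]_x _)%E => [V||] //=; last first.
    by rewrite mulry gtr0_sg// mul1e.
  move=> V0; rewrite -EFinM -EFinD !lee_fin => h.
  (* Comparing masses gave [1 + k * V <= s], hence [V <= 2 * s ^+ 2 / (s + 1)], which is at most
     [s ^+ 2]. *)
  have kE : k * (2 * s ^+ 2) = (s - 1) * (s + 1) by rewrite /k; field; rewrite gt_eqF.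
  have h2 : k * V <= s - 1 by lra.
  have h3 : (s + 1) * (k * V) <= k * (2 * s ^+ 2) by rewrite kE mulrC; nra.
  have h4 : (s + 1) * V <= 2 * s ^+ 2 by rewrite -(ler_pM2l k0) mulrCA.
  by nra.
apply/lee_addgt0Pr => e e0; apply: le_trans (main (Num.sqrt (1 + e)) _) _.
  by rewrite -[ltLHS]sqrtr1 ltr_sqrt; lra.
by rewrite sqr_sqrtr//; lra.
Qed.

End Gaussian.

(** * The compound decision model *)

Section Model.
Variable R : realType.
Local Notation leb := (@lebesgue_measure R).
Variables (n : nat) (ts : 'I_n -> R).

Local Notation phi j := (normal_pdf (ts j) 1).

Definition postmean (t : R) : R := (\sum_j ts j * phi j t) / (\sum_j phi j t).

Lemma sum_phi_gt0 (i : 'I_n) t : 0 < \sum_j phi j t.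
Proof.
rewrite (bigD1 i)//= ltr_wpDr ?normal_pdf1_gt0// sumr_ge0// => j _.
exact: normal_pdf_ge0.
Qed.

Lemma dens_gt0 (s : 'S_n) x : 0 < dens ts s x.
Proof. by apply: prodr_gt0 => i _; apply: normal_pdf1_gt0. Qed.

Lemma sum_dens_gt0 x : 0 < \sum_(s : 'S_n) dens ts s x.
Proof.
rewrite (bigD1 1%g)//= ltr_wpDr ?dens_gt0// sumr_ge0// => s _.
exact/ltW/dens_gt0.
Qed.

(** The image [s i] is uniform, so numerator and denominator are both n! / n times sums over [j]. *)
Lemma thetaSE (i : 'I_n) x : thetaS ts i x = postmean (x i).
Proof.
have n0 : (n%:R : R) != 0 by rewrite pnatr_eq0 -lt0n (leq_ltn_trans _ (ltn_ord i)).
have f0 : (n`!%:R : R) != 0 by rewrite pnatr_eq0 -lt0n fact_gt0.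
have E D : \sum_(s : 'S_n) D (s i) = n`!%:R / n%:R * \sum_j D j :> R.
  by apply: (mulfI n0); rewrite sum_perm1; field.
rewrite /thetaS /postmean (E (fun j => ts j * phi j (x i))) (E (fun j => phi j (x i))).
by rewrite -mulf_div divff ?mul1r// mulf_neq0 ?invr_neq0.
Qed.

Lemma measurable_postmean : measurable_fun setT postmean.
Proof.
apply: measurable_funM.
  apply: measurable_sum => j; apply: measurable_funM => //; exact: measurable_normal_pdf.
apply: measurable_inv_ge0 => [x|].
  by apply: sumr_ge0 => j _; apply: normal_pdf_ge0.
by apply: measurable_sum => j; apply: measurable_normal_pdf.
Qed.

Lemma thetaPI_sqr_dev_le (i : 'I_n) (a : R) x :
  (thetaPI ts i x - a) ^+ 2 * (\sum_s dens ts s x) <=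
  \sum_s dens ts s x * (ts (s i) - a) ^+ 2.
Proof.
rewrite (@weighted_sqr_dev R _ (fun s : 'S_n => dens ts s x) (fun s : 'S_n => ts (s i)) a) ?gt_eqF ?sum_dens_gt0//=.
rewrite [_ * (_ - a) ^+ 2]mulrC lerDr sumr_ge0// => s _.
by rewrite mulr_ge0 ?sqr_ge0// ltW ?dens_gt0.
Qed.

Lemma postmean_dev_sum (i : 'I_n) (a : R) t :
  \sum_j phi j t * (ts j - postmean t) ^+ 2 <= \sum_j phi j t * (ts j - a) ^+ 2.
Proof.
have W := sum_phi_gt0 i t.
rewrite [leRHS](@weighted_sqr_dev _ _ _ ts a) ?gt_eqF// -/(postmean t) lerDl.
by rewrite mulr_ge0 ?sqr_ge0// ltW.
Qed.

(** Pointwise, the posterior mean does at least as well as the observation [x] itself, whose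
    weighted squared error is bounded by [c]. Applied with [b = 1] for the bound by [n] and with
    [far_weight] for the atypical points. *)
Lemma prodsum_mse (b : R -> R) (c : R) :
  measurable_fun setT b -> (forall x, 0 <= b x) ->
  (forall j, \int[leb]_x (phi j x * (ts j - x) ^+ 2 * b x)%:E <= c%:E)%E ->
  exists2 v, v <= n`!%:R * (n%:R * c) &
  prodsum n (fun x => \sum_(s : 'S_n) \sum_i dens ts s x *
    ((ts (s i) - postmean (x i)) ^+ 2 * b (x i))) v.
Proof.
move=> mb b0 bc.
pose u j x := phi j x * (ts j - postmean x) ^+ 2 * b x.
have mphi j : measurable_fun setT (phi j) by exact: measurable_normal_pdf.
have u0 j x : 0 <= u j x by rewrite /u mulr_ge0// mulr_ge0 ?sqr_ge0 ?normal_pdf_ge0.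
have mu j : measurable_fun setT (u j).
  apply: measurable_funM => //; apply: measurable_funM => //.
  by apply: measurable_funX; apply: measurable_funB => //; exact: measurable_postmean.
have mv j : measurable_fun setT (fun x : R => phi j x * (ts j - x) ^+ 2 * b x).
  apply: measurable_funM => //; apply: measurable_funM => //.
  by apply: measurable_funX; apply: measurable_funB.
have usum : (\int[leb]_x (\sum_j u j x)%:E <= (n%:R * c)%:E)%E.
  apply: (@le_trans _ _ (\int[leb]_x (\sum_j (phi j x * (ts j - x) ^+ 2 * b x)%:E))%E).
    apply: ge0_le_integralT => x; first by rewrite lee_fin sumr_ge0.
    rewrite sumEFin lee_fin -!mulr_suml ler_wpM2r//.
    have [i _|noi] := pickP [pred i : 'I_n | true]; first exact: postmean_dev_sum.
    by rewrite !big_pred0.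
  rewrite ge0_integral_sum//; last 2 first.
  - by move=> j; apply/measurable_EFinP; exact: mv.
  - by move=> j x _; rewrite lee_fin mulr_ge0// mulr_ge0 ?sqr_ge0 ?normal_pdf_ge0.
  apply: (@le_trans _ _ (\sum_(j < n) c%:E)%E); first exact: lee_sum.
  by rewrite sumEFin lee_fin sumr_const card_ord mulr_natl.
have ule j : (\int[leb]_x (u j x)%:E <= (n%:R * c)%:E)%E.
  apply: le_trans usum; apply: ge0_le_integralT => x; rewrite lee_fin//.
  by rewrite [leRHS](bigD1 j)//= lerDl sumr_ge0.
pose D j := fine (\int[leb]_x (u j x)%:E).
have DE j : (\int[leb]_x (u j x)%:E = (D j)%:E)%E.
  by have [] := integral_fin_real (u0 j) (ule j).
exists (\sum_(s : 'S_n) \sum_i D (s i)).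
  rewrite exchange_big /=.
  have [n0|n0] := posnP n.
    by rewrite big1 ?n0 ?mul0r ?mulr0// => i _; exfalso; have := leq_ltn_trans (leq0n i) (ltn_ord i); rewrite n0.
  have nR : (0 : R) < n%:R by rewrite ltr0n.
  rewrite -(ler_pM2l nR) mulr_sumr.
  under eq_bigr do rewrite sum_perm1.
  rewrite sumr_const card_ord -[(_ * _) *+ _]mulr_natl ler_pM2l// ler_wpM2l//.
  rewrite -lee_fin; apply: le_trans usum.
  under [in leRHS]eq_integral do rewrite -sumEFin.
  rewrite ge0_integral_sum//; last 2 first.
  - by move=> j; apply/measurable_EFinP; apply: mu.
  - by move=> j x _; rewrite lee_fin.
  by rewrite -sumEFin; apply: lee_sum => j _; rewrite DE.
apply: prodsum_sum => s _; apply: prodsum_sum => i _.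
apply: prodsum_ext (@prodsum_normal_mod _ n (fun l => ts (s l)) i _ _ (mu (s i)) (u0 (s i)) (DE (s i))) _ _ => // x.
by rewrite /dens [in RHS](bigD1 i)//= /u [in RHS]mulrC !mulrA; ring.
Qed.

End Model.

(** * Decoupling *)

Section FfunSum.
Variable R : realType.

Lemma sum_ffun_prod_at n m (rho : 'I_n -> 'I_m -> R) (g : 'I_m -> R) (i : 'I_n) :
  \sum_(y : {ffun 'I_n -> 'I_m}) (\prod_l rho l (y l)) * g (y i) =
  (\prod_(l | l != i) \sum_y rho l y) * \sum_y rho i y * g y.
Proof.
pose rho' l y := if l == i then rho l y * g y else rho l y.
transitivity (\prod_l \sum_y rho' l y).
  rewrite bigA_distr_bigA; apply: eq_bigr => y _.
  rewrite [LHS]mulrC (bigD1 i)//= [RHS](bigD1 i)//= /rho' eqxx mulrCA mulrA; congr (_ * _).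
  by apply: eq_bigr => l /negbTE ->.
rewrite (bigD1 i)//= mulrC; congr (_ * _).
  by apply: eq_bigr => l /negbTE li; apply: eq_bigr => y _; rewrite /rho' li.
by apply: eq_bigr => y _; rewrite /rho' eqxx.
Qed.

Lemma sum_ffun_prob n m (rho G : 'I_n -> 'I_m -> R) (c : R) :
  (forall l, \sum_y rho l y = 1) ->
  \sum_(y : {ffun 'I_n -> 'I_m}) (\prod_l rho l (y l)) * (\sum_i G i (y i) + c) =
  \sum_i \sum_y rho i y * G i y + c.
Proof.
move=> r1; under eq_bigr do rewrite mulrDr mulr_sumr.
rewrite big_split /= exchange_big /=; congr (_ + _).
  by apply: eq_bigr => i _; rewrite sum_ffun_prod_at big1 ?mul1r.
by rewrite -mulr_suml -(bigA_distr_bigA (fun l y => rho l y)) big1 ?mul1r.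
Qed.

End FfunSum.

Section Decoupling.
Variable R : realType.
Local Notation leb := (@lebesgue_measure R).
Variables (n : nat) (ts : 'I_n -> R) (m : nat) (r : 'I_n -> 'I_m -> R) (v : 'I_m -> R).
Hypothesis r0 : forall j y, 0 <= r j y.
Hypothesis r1 : forall j, \sum_y r j y = 1.
Hypothesis rv : forall j, \sum_y r j y * v y = ts j.

Local Notation phi j := (normal_pdf (ts j) 1).
Local Notation postmean := (postmean ts).

(** With [K_j = phi j * r j], this pairs [K_j] and [K_k] relative to the average of the [K_l]. It
    appears when a density multiplies the ratio in [perm_decoupling]; its trace integrates to
    [n * T]. *)
Definition overlap (j k : 'I_n) (t : R) : R :=
  \sum_y (phi j t * r j y) * (phi k t * r k y) / ((\sum_l phi l t * r l y) / n%:R).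

Let phir_ge0 j t y : 0 <= phi j t * r j y.
Proof. by rewrite mulr_ge0// normal_pdf_ge0. Qed.

Lemma overlap_ge0 j k t : 0 <= overlap j k t.
Proof.
by rewrite sumr_ge0// => y _; rewrite divr_ge0// ?mulr_ge0// ?divr_ge0 ?sumr_ge0// ?normal_pdf_ge0.
Qed.

(** Summing over [k] cancels the denominator; where that is 0, so is [phi j t * r j y]. *)
Lemma overlap_sum j t : \sum_k overlap j k t = n%:R * phi j t.
Proof.
transitivity (\sum_y n%:R * (phi j t * r j y)); last first.
  by rewrite -!mulr_sumr r1 mulr1.
rewrite /overlap exchange_big /=; apply: eq_bigr => y _.
rewrite -mulr_suml -mulr_sumr; set S := \sum_(l < n) phi l t * r l y.
have [S0|S0] := eqVneq S 0; last first.
  have nn : (n%:R : R) != 0 by rewrite pnatr_eq0 -lt0n (leq_ltn_trans _ (ltn_ord j)).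
  by field; rewrite nn S0.
have -> : phi j t * r j y = 0; last by rewrite !mul0r mulr0.
apply/le_anti; rewrite phir_ge0 andbT -S0 [leRHS](bigD1 j)//= lerDl.
by rewrite sumr_ge0.
Qed.

Lemma measurable_overlap j k : measurable_fun setT (overlap j k).
Proof.
have mphi l y : measurable_fun setT (fun t => phi l t * r l y).
  by apply: measurable_funM => //; exact: measurable_normal_pdf.
apply: measurable_sum => y; apply: measurable_funM.
  by apply: measurable_funM.
apply: measurable_inv_ge0 => [t|]; first by rewrite divr_ge0// sumr_ge0.
by apply: measurable_funM => //; apply: measurable_sum.
Qed.

(** Sum [perm_decoupling] over all roundings [y], with a test function [F] affine in each
    [v (y i)]. *)
Lemma decoupling_pointwise (x : nat -> R) (lam : 'I_n -> R) (b : R) :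
  (forall i : 'I_n, \sum_j \sum_y (phi j (x i) * r j y) * expR (lam i * (v y - postmean (x i)))
     <= expR (b * lam i ^+ 2) * \sum_j phi j (x i)) ->
  (\sum_(s : 'S_n) dens ts s x) *
    (\sum_(i < n) (lam i * (thetaPI ts i x - postmean (x i)) - b * lam i ^+ 2) + n%:R) <=
  n`!%:R * \prod_(i < n) ((\sum_j phi j (x i)) / n%:R) +
  \sum_(s : 'S_n) \sum_(i < n) (\prod_(l < n | l != i) phi (s l) (x l)) *
     (\sum_(l < n | (i <= l)%N) overlap (s i) (s l) (x i) / (n - i)%:R).
Proof.
move=> Hlam.
pose G (i : 'I_n) (y : 'I_m) := lam i * (v y - postmean (x i)) - b * lam i ^+ 2.
pose F (y : {ffun 'I_n -> 'I_m}) := \sum_i G i (y i).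
pose k (y : {ffun 'I_n -> 'I_m}) (j i : 'I_n) := phi j (x i) * r j (y i).
have : \sum_y \sum_(s : 'S_n) (\prod_i k y (s i) i) * (F y + n%:R) <=
  \sum_y (n`!%:R * expR (F y) * \prod_i ((\sum_j k y j i) / n%:R) +
  \sum_(s : 'S_n) (\prod_i k y (s i) i) *
    \sum_i ((remsum (k y) s i / (n - i)%:R) / ((\sum_j k y j i) / n%:R))).
  by apply: ler_sum => y _; apply: perm_decoupling => j i; exact: phir_ge0.
(* Summing over [y] turns [v (y i)] into [ts (s i)] by unbiasedness; the weighted sum over [s] then
   turns it into [thetaPI]. *)
have -> : \sum_y \sum_(s : 'S_n) (\prod_i k y (s i) i) * (F y + n%:R) =
  (\sum_(s : 'S_n) dens ts s x) *
    (\sum_(i < n) (lam i * (thetaPI ts i x - postmean (x i)) - b * lam i ^+ 2) + n%:R).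
  rewrite exchange_big /=.
  transitivity (\sum_(s : 'S_n) dens ts s x *
      (\sum_(i < n) (lam i * (ts (s i) - postmean (x i)) - b * lam i ^+ 2) + n%:R)).
    apply: eq_bigr => s _.
    under eq_bigr do rewrite /k big_split /= -mulrA.
    rewrite -mulr_sumr; congr (_ * _).
    rewrite (@sum_ffun_prob _ _ _ (fun i => r (s i)))//; congr (_ + _).
    apply: eq_bigr => i _; rewrite /G.
    transitivity (\sum_y (lam i * (r (s i) y * v y) - (lam i * postmean (x i) + b * lam i ^+ 2) * r (s i) y)).
      by apply: eq_bigr => y _; ring.
    by rewrite sumrB -!mulr_sumr r1 rv; ring.
  have D0 := sum_dens_gt0 ts x.
  have PI i : thetaPI ts i x * (\sum_(s : 'S_n) dens ts s x) = \sum_(s : 'S_n) ts (s i) * dens ts s x.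
    by rewrite /thetaPI divfK// gt_eqF.
  transitivity (\sum_(i < n) (lam i * (\sum_(s : 'S_n) ts (s i) * dens ts s x) -
    (lam i * postmean (x i) + b * lam i ^+ 2) * \sum_(s : 'S_n) dens ts s x) + n%:R * \sum_(s : 'S_n) dens ts s x).
    under eq_bigr do rewrite mulrDr mulr_sumr.
    rewrite big_split /= -mulr_suml [n%:R * _]mulrC; congr (_ + _).
    rewrite exchange_big /=; apply: eq_bigr => i _.
    by rewrite !mulr_sumr -sumrB; apply: eq_bigr => s _; ring.
  rewrite mulrDr [n%:R * _]mulrC; congr (_ + _); rewrite mulr_sumr.
  by apply: eq_bigr => i _; rewrite -PI; ring.
move=> /le_trans; apply; rewrite big_split /=; apply: lerD.
  (* [expR (F y)] factorizes over coordinates, so the sum over [y] is a product of one-coordinate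
     sums, each bounded by [Hlam]. *)
  under eq_bigr do rewrite -mulrA /F expR_sum -big_split /=.
  rewrite -mulr_sumr ler_wpM2l//.
  rewrite -(bigA_distr_bigA (fun i y => expR (G i y) * ((\sum_j phi j (x i) * r j y) / n%:R))).
  apply: ler_prod => i _; apply/andP; split.
    by apply: sumr_ge0 => y _; rewrite mulr_ge0 ?expR_ge0 ?divr_ge0// sumr_ge0.
  have := ler_wpM2l (expR_ge0 (- (b * lam i ^+ 2))) (Hlam i).
  rewrite [X in _ <= X]mulrA -expRD addNr expR0 mul1r => h.
  under eq_bigr do rewrite mulrA; rewrite -mulr_suml ler_wpM2r ?invr_ge0//.
  apply: le_trans h; rewrite exchange_big /= mulr_sumr le_eqVlt; apply/orP; left; apply/eqP.
  apply: eq_bigr => y _; rewrite /G expRD !mulr_sumr; apply: eq_bigr => j _; ring.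
(* The [i]-th ratio depends on [y] only through [y i]; the other roundings sum to 1. *)
rewrite exchange_big /=; apply: ler_sum => s _.
under eq_bigr do rewrite mulr_sumr.
rewrite exchange_big /=; apply: ler_sum => i _.
have := @sum_ffun_prod_at R n m (fun l y => phi (s l) (x l) * r (s l) y)
  (fun y => ((\sum_(l < n | (i <= l)%N) phi (s l) (x i) * r (s l) y) / (n - i)%:R) /
     ((\sum_j phi j (x i) * r j y) / n%:R)) i.
rewrite /k /remsum => ->.
rewrite le_eqVlt; apply/orP; left; apply/eqP; congr (_ * _).
  by apply: eq_bigr => l _; rewrite -mulr_sumr r1 mulr1.
rewrite /overlap; under [RHS]eq_bigr do rewrite mulr_suml.
rewrite [RHS]exchange_big /=; apply: eq_bigr => y _.
by rewrite !mulr_suml mulr_sumr; apply: eq_bigr => l _; ring.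
Qed.

End Decoupling.

(** * Integrating the decoupled bound *)

Section Overlap.
Variable R : realType.
Local Notation leb := (@lebesgue_measure R).
Variables (n : nat) (ts : 'I_n -> R) (m : nat) (r : 'I_n -> 'I_m -> R).
Hypothesis r0 : forall j y, 0 <= r j y.
Hypothesis r1 : forall j, \sum_y r j y = 1.

Local Notation phi j := (normal_pdf (ts j) 1).

(** At step [i], the term [l = i] averages to at most [T / (n - i)]. Each of the others averages to
    at most [n / (n - 1)] before division by [n - i], since the integrated overlaps have row sums
    [n]. *)
Lemma prodsum_decoupling (T : R) : (1 < n)%N -> 0 <= T ->
  (\int[leb]_x (\sum_j overlap ts r j j x)%:E <= (n%:R * T)%:E)%E ->
  exists2 V, V <= n`!%:R * (1 + T * \sum_(i < n) (n - i)%:R^-1 + n%:R * (n%:R / n.-1%:R)) &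
  prodsum n (fun x => n`!%:R * \prod_(i < n) ((\sum_j phi j (x i)) / n%:R) +
    \sum_(s : 'S_n) \sum_(i < n) (\prod_(l < n | l != i) phi (s l) (x l)) *
     (\sum_(l < n | (i <= l)%N) overlap ts r (s i) (s l) (x i) / (n - i)%:R)) V.
Proof.
move=> n1 T0 oT.
have n0 : (0 < n)%N by exact: ltnW.
have nR : (0 : R) < n%:R by rewrite ltr0n.
have n1R : (0 : R) < n.-1%:R by rewrite ltr0n -ltnS prednK.
have mphi j : measurable_fun setT (phi j) by exact: measurable_normal_pdf.
have mS : measurable_fun setT (fun x : R => \sum_j phi j x).
  by apply: measurable_sum.
have phi0 j x : 0 <= phi j x by exact: normal_pdf_ge0.
have ov0 := @overlap_ge0 R n ts m r r0.
have ovm := @measurable_overlap R n ts m r r0.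
have ole j k : (\int[leb]_x (overlap ts r j k x)%:E <= (n%:R)%:E)%E.
  apply: (@le_trans _ _ (\int[leb]_x (n%:R%:E * (phi j x)%:E))%E).
    apply: ge0_le_integralT => x; rewrite lee_fin// -(overlap_sum ts r0 r1 j x).
    by rewrite [leRHS](bigD1 k)//= lerDl sumr_ge0.
  rewrite ge0_integralZl//; last 2 first.
  - by apply/measurable_EFinP; apply: mphi.
  - by move=> x _; rewrite lee_fin.
  by rewrite integral_normal_pdf mule1.
pose B j k := fine (\int[leb]_x (overlap ts r j k x)%:E).
have BE j k : (\int[leb]_x (overlap ts r j k x)%:E = (B j k)%:E)%E.
  by have [] := integral_fin_real (ov0 j k) (ole j k).
have B0 j k : 0 <= B j k.
  by have [] := integral_fin_real (ov0 j k) (ole j k).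
have Bsum j : \sum_k B j k = n%:R.
  apply: EFin_inj; rewrite -sumEFin; under eq_bigr do rewrite -BE.
  rewrite -ge0_integral_sum//; last 2 first.
  - by move=> k; apply/measurable_EFinP; apply: ovm.
  - by move=> k x _; rewrite lee_fin.
  transitivity (\int[leb]_x (n%:R%:E * (phi j x)%:E))%E.
    by apply: eq_integral => x _; rewrite sumEFin overlap_sum.
  rewrite ge0_integralZl//; last 2 first.
  - by apply/measurable_EFinP; apply: mphi.
  - by move=> x _; rewrite lee_fin.
  by rewrite integral_normal_pdf mule1.
have Btr : \sum_j B j j <= n%:R * T.
  rewrite -lee_fin -sumEFin; under eq_bigr do rewrite -BE.
  rewrite -ge0_integral_sum//; last 2 first.
  - by move=> k; apply/measurable_EFinP; apply: ovm.
  - by move=> k x _; rewrite lee_fin.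
  by apply: le_trans oT; apply: ge0_le_integralT => x; rewrite sumEFin// lee_fin sumr_ge0.
exists (n`!%:R * 1 + \sum_(s : 'S_n) \sum_(i < n) \sum_(l < n | (i <= l)%N) (n - i)%:R^-1 * B (s i) (s l)).
  rewrite -addrA mulrDr lerD2l exchange_big /=.
  have np (i : 'I_n) : (0 : R) < (n - i)%:R by rewrite ltr0n subn_gt0.
  have diag (i : 'I_n) : \sum_(s : 'S_n) B (s i) (s i) <= n`!%:R * T.
    rewrite -(ler_pM2l nR) (sum_perm1 (fun j => B j j) i) mulrCA.
    by rewrite ler_wpM2l.
  have off (i l : 'I_n) : l != i -> \sum_(s : 'S_n) B (s i) (s l) <= n`!%:R * (n%:R / n.-1%:R).
    move=> li; rewrite -(ler_pM2l n1R).
    apply: le_trans (sum_perm2_le B0 Bsum li) _.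
    by rewrite le_eqVlt; apply/orP; left; apply/eqP; field; rewrite gt_eqF.
  have -> : n`!%:R * (T * \sum_(i < n) (n - i)%:R^-1 + n%:R * (n%:R / n.-1%:R)) =
     \sum_(i < n) (n`!%:R * T * (n - i)%:R^-1 + n`!%:R * (n%:R / n.-1%:R)) :> R.
    rewrite big_split /= -mulr_sumr sumr_const card_ord -[_ *+ n]mulr_natl.
    by ring.
  apply: ler_sum => i _; rewrite exchange_big /=.
  under eq_bigr do rewrite -mulr_sumr.
  rewrite -mulr_sumr -(ler_pM2l (np i)) mulVKf ?gt_eqF// mulrDr.
  rewrite [X in _ <= X + _]mulrC divfK ?gt_eqF// (bigD1 i)//=.
  apply: lerD => //.
  (* Putting the diagonal index back gives exactly [n - i] equal terms. *)
  apply: (@le_trans _ _ (\sum_(l < n | (i <= l)%N) n`!%:R * (n%:R / n.-1%:R))).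
    rewrite big_mkcondr /=; apply: ler_sum => l _; case: ifP => [/off//|_].
    by rewrite mulr_ge0 ?divr_ge0.
  rewrite -(big_geq_mkord i n xpredT (fun=> n`!%:R * (n%:R / n.-1%:R))) /=.
  by rewrite sumr_const_nat [leRHS]mulr_natl.
apply: prodsumD.
  apply: prodsumZ => //.
  apply: prodsum_ext (@prodsum_prod _ n (fun=> fun t => (\sum_j phi j t) / n%:R) (fun=> 1) _ _ _) _ _ => //.
  - by move=> i; apply: measurable_funM => //; apply: measurable_sum.
  - by move=> i t; rewrite divr_ge0// sumr_ge0.
  - move=> i; under eq_integral do rewrite EFinM muleC.
    rewrite ge0_integralZl//; last 2 first.
    + by apply/measurable_EFinP; apply: mS.
    + by move=> x _; rewrite lee_fin sumr_ge0.
    under eq_integral do rewrite -sumEFin.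
    rewrite ge0_integral_sum//; last 2 first.
    + by move=> j; apply/measurable_EFinP; apply: mphi.
    + by move=> j x _; rewrite lee_fin.
    under eq_bigr do rewrite integral_normal_pdf.
    by rewrite sumEFin sumr_const card_ord -EFinM mulVf// gt_eqF.
  - by rewrite big1.
apply: prodsum_sum => s _; apply: prodsum_sum => i _.
apply: prodsum_ext (@prodsum_sum _ _ _ (index_enum 'I_n) (fun l : 'I_n => (i <= l)%N) (fun l x => (n - i)%:R^-1 *
   ((\prod_(l < n | l != i) phi (s l) (x l)) * overlap ts r (s i) (s l) (x i))) (fun l => (n - i)%:R^-1 * B (s i) (s l)) _) _ _ => //.
  move=> l _; apply: prodsumZ; first by rewrite invr_ge0.
  by apply: (@prodsum_normal_mod _ n (fun l => ts (s l))).
by move=> x; rewrite mulr_sumr; apply: eq_bigr => l _; ring.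
Qed.

End Overlap.

(** * Rounding kernel and posterior tails *)

Section Rounding.
Variable R : realType.

(** After a shift by [N > mu], round up with probability the fractional part [f j] and down
    otherwise. The [2 * N + 1] values are at most [6 * mu] in number since [mu >= 1]. *)
Lemma unbiased_rounding n (ts : 'I_n -> R) (mu : R) :
  1 <= mu -> (forall j, `|ts j| <= mu) ->
  exists (m : nat) (r : 'I_n -> 'I_m -> R) (v : 'I_m -> R),
  [/\ m%:R <= 6 * mu, forall j y, 0 <= r j y, forall j, \sum_y r j y = 1,
      forall j, \sum_y r j y * v y = ts j &
      forall j y, r j y != 0 -> `|v y - ts j| <= 1].
Proof.
move=> mu1 tsmu; pose N := (Num.truncn mu).+1.
have /andP[N1 N2] := truncn_itv (le_trans ler01 mu1).
have NE : N%:R = (Num.truncn mu)%:R + 1 :> R by rewrite /N -natr1.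
have muN : mu < N%:R by [].
have tsN j : 0 <= ts j + N%:R by have := tsmu j; rewrite ler_norml => /andP[]; lra.
pose a j := Num.truncn (ts j + N%:R); pose f j := ts j + N%:R - (a j)%:R.
have fa j : 0 <= f j <= 1.
  by have := truncn_itv (tsN j); rewrite /f /a -natr1 => /andP[]; lra.
have alt j : ((a j).+1 < N.*2.+1)%N.
  rewrite ltnS -(ltr_nat R) -addnn natrD.
  have := truncn_itv (tsN j) => /andP[+ _]; rewrite -/(a j).
  have := tsmu j; rewrite ler_norml => /andP[_]; lra.
pose r j (y : 'I_N.*2.+1) : R :=
  (1 - f j) *+ (y == a j :> nat) + f j *+ (y == (a j).+1 :> nat).
have rE (g : 'I_N.*2.+1 -> R) j : \sum_y r j y * g y =
    (1 - f j) * g (Ordinal (ltnW (alt j))) + f j * g (Ordinal (alt j)).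
  under eq_bigr do rewrite mulrDl.
  rewrite big_split /=; congr (_ + _).
    rewrite (bigD1 (Ordinal (ltnW (alt j))))//= eqxx big1 ?addr0// => y yj.
    by rewrite [X in _ *+ X](_ : _ = 0%N) ?mul0r//; apply/eqP; rewrite eqb0; apply: contra yj => /eqP e; apply/eqP/val_inj.
  rewrite (bigD1 (Ordinal (alt j)))//= eqxx big1 ?addr0// => y yj.
  by rewrite [X in _ *+ X](_ : _ = 0%N) ?mul0r//; apply/eqP; rewrite eqb0; apply: contra yj => /eqP e; apply/eqP/val_inj.
exists N.*2.+1, r, (fun y => y%:R - N%:R); split.
- by rewrite -natr1 -addnn natrD NE; lra.
- by move=> j y; have := fa j => /andP[? ?]; rewrite addr_ge0// mulrn_wge0//; lra.
- by move=> j; under eq_bigr do rewrite -[r _ _]mulr1; rewrite rE; lra.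
- by move=> j; rewrite rE /= -natr1 /f; ring.
- move=> j y; rewrite /r; have := fa j; rewrite /f => fj.
  have [-> _|_] := eqVneq (y : nat) (a j); first by rewrite ler_norml; lra.
  have [-> _|_] := eqVneq (y : nat) (a j).+1; first by rewrite -natr1 ler_norml; lra.
  by rewrite addr0 eqxx.
Qed.

End Rounding.

Section Trace.
Variable R : realType.
Local Notation leb := (@lebesgue_measure R).
Variables (n : nat) (ts : 'I_n -> R) (m : nat) (r : 'I_n -> 'I_m -> R) (v : 'I_m -> R).
Hypothesis r0 : forall j y, 0 <= r j y.
Hypothesis r1 : forall j, \sum_y r j y = 1.
Hypothesis rnear : forall j y, r j y != 0 -> `|v y - ts j| <= 1.

Local Notation phi j := (normal_pdf (ts j) 1).

(** Doubling the variance absorbs the shift, as [(x - b) ^+ 2 <= 2 * (x - a) ^+ 2 + 2 * (b - a) ^+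
    2]. The majorant does not depend on [a]. *)
Lemma normal_pdf_near (a b x : R) : `|b - a| <= 1 ->
  normal_pdf a 1 x <= expR (1 / 2) * Num.sqrt 2 * normal_pdf b (Num.sqrt 2) x.
Proof.
move=> ab; rewrite normal_pdf1E -mulrA -normal_pdf_scale ?sqrtr_gt0//.
rewrite mulrCA ler_wpM2l ?normal_peak_ge0// -expRD ler_expR sqr_sqrtr//.
rewrite -[2 *+ 2]mulr_natr.
have -> : 1 / 2 + - (x - b) ^+ 2 / (2 * 2) = 1 / 2 - (x - b) ^+ 2 / 4 :> R by field.
have h : (b - a) ^+ 2 <= 1 by rewrite -[leRHS](expr1n _ 2) -(real_normK (num_real (b - a))) lerXn2r ?nnegrE.
have : 0 <= (x - a - (b - a) * -1) ^+ 2 by exact: sqr_ge0.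
have : (x - b) ^+ 2 + (x - a - (b - a) * -1) ^+ 2 = 2 * (x - a) ^+ 2 + 2 * (b - a) ^+ 2 by ring.
lra.
Qed.

(** For fixed [y], every [K_j] lies below the same multiple [c * q y] of a normal density. So the
    sum of the [K_j ^ 2] is at most [c * q y] times the sum of the [K_j], and each [y] contributes
    at most [n * c]. *)
Lemma trace_overlap :
  (\int[leb]_x (\sum_j overlap ts r j j x)%:E <=
   (n%:R * (m%:R * (expR (1 / 2) * Num.sqrt 2)))%:E)%E.
Proof.
pose c : R := expR (1 / 2) * Num.sqrt 2.
have c0 : 0 <= c by rewrite mulr_ge0 ?expR_ge0 ?sqrtr_ge0.
pose q y x := normal_pdf (v y) (Num.sqrt 2) x.
have q0 y x : 0 <= q y x by exact: normal_pdf_ge0.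
have r_le1 j y : r j y <= 1.
  by rewrite -(r1 j) (bigD1 y)//= lerDl sumr_ge0.
have phir0 j y x : 0 <= phi j x * r j y by rewrite mulr_ge0 ?normal_pdf_ge0.
have ov_le x : \sum_j overlap ts r j j x <= \sum_y n%:R * c * q y x.
  rewrite /overlap exchange_big /=; apply: ler_sum => y _.
  have cap j : phi j x * r j y <= c * q y x.
    have [->|rjy] := eqVneq (r j y) 0; first by rewrite mulr0 mulr_ge0.
    apply: le_trans (normal_pdf_near x (rnear rjy)).
    by rewrite ler_piMr ?normal_pdf_ge0.
  rewrite -mulr_suml; set S := \sum_(l < n) phi l x * r l y.
  have S0 : 0 <= S by rewrite sumr_ge0.
  have [Se|Sn] := eqVneq S 0.
    by rewrite Se mul0r invr0 mulr0 !mulr_ge0.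
  have Sp : 0 < S by rewrite lt_neqAle eq_sym Sn.
  rewrite invfM invrK mulrA mulrAC ler_pdivrMr//.
  rewrite mulrC (_ : n%:R * c * q y x * S = n%:R * (c * q y x * S)); last by ring.
  rewrite ler_wpM2l// /S mulr_sumr.
  by apply: ler_sum => j _; rewrite ler_wpM2r.
apply: (@le_trans _ _ (\int[leb]_x (\sum_y (n%:R * c)%:E * (q y x)%:E))%E).
  apply: ge0_le_integralT => x; first by rewrite lee_fin sumr_ge0// => j _; apply: overlap_ge0.
  by under [leRHS]eq_bigr do rewrite -EFinM; rewrite sumEFin lee_fin.
rewrite ge0_integral_sum//; last 2 first.
- by move=> y; apply: measurable_funeM; apply/measurable_EFinP; apply: measurable_normal_pdf.
- by move=> y x _; rewrite -EFinM lee_fin !mulr_ge0.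
rewrite (eq_bigr (fun=> (n%:R * c)%:E)) => [|y _]; last first.
  rewrite ge0_integralZl//; last 3 first.
  - by apply/measurable_EFinP; apply: measurable_normal_pdf.
  - by move=> x _; rewrite lee_fin.
  - by rewrite lee_fin mulr_ge0.
  by rewrite integral_normal_pdf mule1.
by rewrite sumEFin lee_fin sumr_const card_ord -[_ *+ m]mulr_natl mulrCA.
Qed.

End Trace.

(** * Points near and far from the means *)

Section Good.
Variable R : realType.
Local Notation leb := (@lebesgue_measure R).
Variables (n : nat) (ts : 'I_n -> R).
Local Notation phi j := (normal_pdf (ts j) 1).

(* A measurable substitute for the indicator of the points far from all the
   means: it exceeds 1 exactly where the posterior may fail to be concentrated,
   and it is small on average. *)
Definition far_weight (x : R) : R := (n%:R * \sum_j expR (- (x - ts j) ^+ 2 / 4))^-1.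

Lemma far_weight_ge0 x : 0 <= far_weight x.
Proof. by rewrite invr_ge0 mulr_ge0 ?sumr_ge0// => j _; exact: expR_ge0. Qed.

Lemma measurable_far_weight : measurable_fun setT far_weight.
Proof.
apply: measurable_inv_ge0 => [x|]; first by rewrite mulr_ge0 ?sumr_ge0// => j _; exact: expR_ge0.
apply: measurable_funM => //; apply: measurable_sum => j.
apply: measurableT_comp => //; apply: measurable_funM => //.
by apply: measurableT_comp => //; apply: measurable_funX; apply: measurable_funB.
Qed.

Lemma far_weight_le (j : 'I_n) x : far_weight x <= n%:R^-1 * expR ((x - ts j) ^+ 2 / 4).
Proof.
have nR : (0 : R) < n%:R by rewrite ltr0n (leq_ltn_trans _ (ltn_ord j)).
rewrite /far_weight invfM ler_wpM2l ?invr_ge0//.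
have -> : expR ((x - ts j) ^+ 2 / 4) = (expR (- (x - ts j) ^+ 2 / 4))^-1.
  by rewrite -expRN mulNr opprK.
rewrite lef_pV2 ?posrE ?expR_gt0//; last first.
  by rewrite (bigD1 j)//= ltr_wpDr ?expR_gt0// sumr_ge0// => l _; exact: expR_ge0.
by rewrite (bigD1 j)//= lerDl sumr_ge0// => l _; exact: expR_ge0.
Qed.

(** With [z = (x - ts j) ^+ 2], the weight costs [z / 4] in the exponent and [z <= 8 * expR (z / 8)]
    costs [z / 8]. What remains of [- z / 2] is [- z / 8], the exponent for standard deviation 2. *)
Lemma far_mse (j : 'I_n) :
  (\int[leb]_x (phi j x * (ts j - x) ^+ 2 * far_weight x)%:E <= (16 / n%:R)%:E)%E.
Proof.
apply: (@le_trans _ _ (\int[leb]_x ((16 / n%:R)%:E * (normal_pdf (ts j) 2 x)%:E))%E); last first.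
  rewrite ge0_integralZl//.
  - by rewrite integral_normal_pdf mule1.
  - by apply/measurable_EFinP; apply: measurable_normal_pdf.
  - by move=> x _; rewrite lee_fin normal_pdf_ge0.
apply: ge0_le_integralT => x.
  by rewrite lee_fin mulr_ge0 ?far_weight_ge0// mulr_ge0 ?sqr_ge0 ?normal_pdf_ge0.
rewrite -EFinM lee_fin.
have p0 : 0 <= phi j x * (ts j - x) ^+ 2 by rewrite mulr_ge0 ?sqr_ge0 ?normal_pdf_ge0.
apply: le_trans (ler_wpM2l p0 (far_weight_le j x)) _.
have -> : 16 / n%:R * normal_pdf (ts j) 2 x = 8 / n%:R * (2 * normal_pdf (ts j) 2 x) by ring.
rewrite -normal_pdf_scale// normal_pdf1E.
set z := (x - ts j) ^+ 2; have -> : (ts j - x) ^+ 2 = z by rewrite /z; ring.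
have z8 : z <= 8 * expR (z / 8) by have := expR_ge1Dx (z / 8); lra.
have -> : - z / (2 ^+ 2 *+ 2) = - z / 2 + z / 4 + z / 8 by rewrite -[_ *+ 2]mulr_natr; field.
rewrite !expRD.
set e1 := expR _; set e2 := expR (z / 4); set e3 := expR _ in z8 *.
have k0 : 0 <= normal_peak 1 * e1 * e2 * n%:R^-1.
  by rewrite !mulr_ge0 ?invr_ge0 ?expR_ge0 ?normal_peak_ge0.
have := ler_wpM2l k0 z8; lra.
Qed.

End Good.

Section GoodMgf.
Variable R : realType.
Variables (n : nat) (ts : 'I_n -> R) (m : nat) (r : 'I_n -> 'I_m -> R) (v : 'I_m -> R).
Hypothesis r0 : forall j y, 0 <= r j y.
Hypothesis r1 : forall j, \sum_y r j y = 1.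
Hypothesis rv : forall j, \sum_y r j y * v y = ts j.
Hypothesis rnear : forall j y, r j y != 0 -> `|v y - ts j| <= 1.

Local Notation phi j := (normal_pdf (ts j) 1).

(** In terms of [a j] and their sum [S], the claim is that [S] is at most [n ^ 2] times the sum of
    the [a j ^+ 2]. The hypothesis says [1 <= n * S], so [S <= n * S ^ 2], and Cauchy-Schwarz
    concludes. *)
Lemma near_exp_moment (i : 'I_n) x : far_weight ts x <= 1 ->
  \sum_j phi j x * expR ((x - ts j) ^+ 2 / 4) <= n%:R ^+ 2 * \sum_j phi j x.
Proof.
have nR : (0 : R) < n%:R by rewrite ltr0n (leq_ltn_trans _ (ltn_ord i)).
pose a j := expR (- (x - ts j) ^+ 2 / 4).
have a0 j : 0 < a j by exact: expR_gt0.
pose S := \sum_j a j.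
have S0 : 0 < S by rewrite /S (bigD1 i)//= ltr_wpDr// sumr_ge0// => j _; exact: ltW.
rewrite /far_weight -/S invf_le1 ?mulr_gt0// => nS.
have -> : \sum_j phi j x * expR ((x - ts j) ^+ 2 / 4) = normal_peak 1 * S.
  rewrite /S mulr_sumr; apply: eq_bigr => j _; rewrite normal_pdf1E -mulrA -expRD.
  by congr (_ * expR _); field.
have -> : \sum_j phi j x = normal_peak 1 * \sum_j a j ^+ 2.
  rewrite mulr_sumr; apply: eq_bigr => j _; rewrite normal_pdf1E /a [expR _ ^+ 2]expr2 -expRD.
  by congr (_ * expR _); field.
rewrite mulrCA ler_wpM2l ?normal_peak_ge0//.
(* Cauchy-Schwarz *)
have cs : S ^+ 2 <= n%:R * \sum_j a j ^+ 2.
  have n0 : \sum_(j < n) (1 : R) != 0 by rewrite sumr_const card_ord gt_eqF.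
  have := weighted_sqr_dev a 0 n0; rewrite /= !sumr_const !card_ord.
  rewrite (eq_bigr (fun j => a j ^+ 2)) => [->|j _]; last by rewrite mul1r subr0.
  rewrite [X in X / _](eq_bigr a) => [|j _]; last by rewrite mulr1.
  rewrite -/S subr0 mulrDr.
  have -> : n%:R * (n%:R * (S / n%:R) ^+ 2) = S ^+ 2 by field; rewrite gt_eqF.
  by rewrite lerDr mulr_ge0// sumr_ge0// => j _; rewrite mulr_ge0 ?sqr_ge0.
have h1 : S <= n%:R * S * S by rewrite -[leLHS]mul1r ler_wpM2r// ltW.
apply: le_trans h1 _.
by rewrite -mulrA -expr2 [in leRHS]expr2 -mulrA ler_wpM2l// ltW.
Qed.

(** Here [l] is [2 * ln n]. Under the posterior of index and rounding, [v y] minus its mean has an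
    exponential square moment at scale [12 * l] of at most [2 * expR 3], as [subgaussian_mgf]
    requires. *)
Lemma good_mgf (i : 'I_n) x (l lam : R) : 1 <= l -> expR l = n%:R ^+ 2 ->
  far_weight ts x <= 1 ->
  \sum_j \sum_y (phi j x * r j y) * expR (lam * (v y - postmean ts x)) <=
  expR (2 * (2 * expR 3) * (12 * l) * lam ^+ 2) * \sum_j phi j x.
Proof.
move=> l1 el xnear; have l0 : 0 < l by lra.
have W0 := sum_phi_gt0 ts i x.
set W := \sum_j phi j x in W0 *; set p := postmean ts x.
have phi0 j : 0 <= phi j x by exact: normal_pdf_ge0.
pose u j := (x - ts j) ^+ 2.
have u0 j : 0 <= u j by exact: sqr_ge0.
have pW : p * W = \sum_j ts j * phi j x by rewrite /p /postmean divfK// gt_eqF.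
have mom : \sum_j phi j x * expR (u j / 4 - l) <= W.
  rewrite (eq_bigr (fun j => (expR l)^-1 * (phi j x * expR (u j / 4)))); last first.
    by move=> j _; rewrite expRD expRN; ring.
  rewrite -mulr_sumr ler_pdivrMl ?expR_gt0// el.
  exact: near_exp_moment.
(* The left side is at most the posterior mean of [u], and [u j <= 4 * (l - 1) + 4 * expR (u j / 4 -
   l)] has mean at most [4 * l] by [mom]. *)
have d2 : (x - p) ^+ 2 <= 4 * l.
  have h1 : W * (x - p) ^+ 2 <= \sum_j phi j x * u j.
    rewrite /u; under eq_bigr do rewrite -sqrrN opprB.
    rewrite (@weighted_sqr_dev _ _ _ ts x) ?gt_eqF// -/W -/(postmean ts x) -/p.
    rewrite -[(x - p) ^+ 2]sqrrN opprB lerDr sumr_ge0// => j _.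
    by rewrite mulr_ge0 ?sqr_ge0.
  rewrite -(ler_pM2l W0); apply: le_trans h1 _.
  apply: (@le_trans _ _ (\sum_j (4 * ((l - 1) * phi j x) + 4 * (phi j x * expR (u j / 4 - l))))).
    apply: ler_sum => j _.
    have := ler_wpM2l (phi0 j) (expR_ge1Dx (u j / 4 - l)); lra.
  rewrite big_split /= -!mulr_sumr -/W; lra.
pose w (q : 'I_n * 'I_m) := phi q.1 x * r q.1 q.2.
pose Z (q : 'I_n * 'I_m) := v q.2 - p.
have w0 q : 0 <= w q by rewrite mulr_ge0.
have sw (g : 'I_n -> R) : \sum_q w q * g q.1 = \sum_j phi j x * g j.
  rewrite -(pair_bigA _ (fun j y => phi j x * r j y * g j)) /=; apply: eq_bigr => j _.
  by rewrite -mulr_suml -mulr_sumr r1 mulr1.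
have sw1 : \sum_q w q = W.
  by have := sw (fun=> 1); under eq_bigr do rewrite mulr1; under [RHS]eq_bigr do rewrite mulr1.
rewrite (pair_bigA _ (fun j y => phi j x * r j y * expR (lam * (v y - p)))) /= -sw1.
apply: (@subgaussian_mgf R _ w Z (12 * l) (2 * expR 3) lam) => //.
- by rewrite mulr_gt0.
- by have := expR_ge1Dx (3 : R); lra.
- rewrite -(pair_bigA _ (fun j y => phi j x * r j y * (v y - p))) /=.
  rewrite (eq_bigr (fun j => ts j * phi j x - p * phi j x)) => [|j _].
    by rewrite sumrB -pW -mulr_sumr subrr.
  under eq_bigr do rewrite -mulrA mulrBr.
  by rewrite -mulr_sumr sumrB rv -mulr_suml r1; ring.
apply: (@le_trans _ _ (\sum_q w q * (expR 3 * (1 + expR (u q.1 / 4 - l))))).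
  apply: ler_sum => -[j y] _ /=; rewrite /w /Z /=.
  have [->|rjy] := eqVneq (r j y) 0; first by rewrite mulr0 !mul0r.
  rewrite ler_wpM2l ?mulr_ge0//.
  (* Split the deviation into the rounding error, the distance from [ts j] to [x] and the distance
     from [x] to [p]. *)
  have Z2 : (v y - p) ^+ 2 <= 3 * (1 + u j + 4 * l).
    have h : (v y - ts j) ^+ 2 <= 1.
      by rewrite -[leRHS](expr1n _ 2) -(real_normK (num_real (v y - ts j))) lerXn2r ?nnegrE// rnear.
    have e1 : v y - p = (v y - ts j) - (x - ts j) + (x - p) by ring.
    have := sqr_ge0 ((v y - ts j) + (x - ts j)).
    have := sqr_ge0 ((v y - ts j) - (x - p)).
    have := sqr_ge0 ((x - ts j) + (x - p)).
    rewrite e1 /u; move: (v y - ts j) (x - ts j) (x - p) h d2 => A B D h d2.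
    nra.
  have Zl : (v y - p) ^+ 2 / (12 * l) <= 3 + (u j / 4 - l) / l.
    rewrite ler_pdivrMr ?mulr_gt0//.
    have -> : (3 + (u j / 4 - l) / l) * (12 * l) = 24 * l + 3 * u j by field; rewrite gt_eqF.
    lra.
  apply: (@le_trans _ _ (expR (3 + (u j / 4 - l) / l))); first by rewrite ler_expR.
  rewrite expRD ler_wpM2l ?expR_ge0//.
  set t := u j / 4 - l.
  have [t0|t0] := lerP 0 t.
    apply: (@le_trans _ _ (expR t)); last by rewrite lerDr.
    rewrite ler_expR ler_pdivrMr//; nra.
  apply: (@le_trans _ _ 1); last by rewrite lerDl expR_ge0.
  by rewrite -[leRHS]expR0 ler_expR pmulr_lle0 ?invr_gt0// ltW.
rewrite (sw (fun j => expR 3 * (1 + expR (u j / 4 - l)))) sw1.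
rewrite (eq_bigr (fun j => expR 3 * (phi j x + phi j x * expR (u j / 4 - l)))) => [|j _]; last by ring.
rewrite -mulr_sumr big_split /= -/W -mulrA [2 * _]mulrC -mulrA ler_wpM2l ?expR_ge0//; lra.
Qed.

End GoodMgf.

(** * Numerical bounds *)

Section Numeric.
Variable R : realType.

(** Each new term satisfies [1 / k <= ln (k / (k - 1))], from [ln (1 - 1 / k) <= - 1 / k]. *)
Lemma harmonic_le_ln n : (0 < n)%N ->
  \sum_(i < n) (n - i)%:R^-1 <= 1 + ln n%:R :> R.
Proof.
case: n => // n _; elim: n => [|n IH].
  by rewrite big_ord1 ln1 addr0 subn0 invr1.
rewrite big_ord_recl subn0.
have -> : \sum_(i < n.+1) (n.+2 - lift ord0 i)%:R^-1 = \sum_(i < n.+1) (n.+1 - i)%:R^-1 :> R.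
  by apply: eq_bigr => i _; rewrite /= /bump /= add1n subSS.
apply: (le_trans (lerD (lexx _) IH)).
have n1 : (0 : R) < n.+1%:R by rewrite ltr0n.
have n2 : (0 : R) < n.+2%:R by rewrite ltr0n.
have e : n.+2%:R = n.+1%:R + 1 :> R by rewrite natr1.
have inv1 : n.+2%:R^-1 < 1 :> R by rewrite invf_lt1// e ltrDr.
have : ln (1 + - n.+2%:R^-1) <= - n.+2%:R^-1 :> R by apply: le_ln1Dx; rewrite ltrN2.
have -> : 1 + - n.+2%:R^-1 = n.+1%:R / n.+2%:R :> R.
  have X (a b : R) : 0 < b -> b = a + 1 -> 1 + - b^-1 = a / b.
    move=> b0 ba; have -> : a = b - 1 by lra.
    by field; rewrite gt_eqF.
  exact: X.
rewrite ln_div ?posrE//; move: (ln _) (ln _) (_^-1) => a b c; lra.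
Qed.

Lemma ln_nat_ge_half n : (1 < n)%N -> 1 / 2 <= ln n%:R :> R.
Proof.
move=> n1; have h2 : (1 : R) / 2 <= ln 2.
  have : ln (1 + - (1 / 2)) <= - (1 / 2) :> R by apply: le_ln1Dx; lra.
  rewrite (_ : 1 + - (1 / 2) = 2^-1); last by field.
  by rewrite lnV ?posrE//; lra.
by apply: le_trans h2 _; rewrite ler_ln ?posrE// ?ltr0n ?ler_nat// (ltnW n1).
Qed.

End Numeric.

(** * Risk bounds *)

Section Risk.
Variable R : realType.
Variables (n : nat) (ts : 'I_n -> R).
Local Notation phi j := (normal_pdf (ts j) 1).

Definition sqr_gap (x : nat -> R) : R :=
  \sum_(s : 'S_n) (\sum_(i < n) (thetaS ts i x - thetaPI ts i x) ^+ 2) * dens ts s x.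

Lemma sqr_gap_ge0 x : 0 <= sqr_gap x.
Proof.
by rewrite sumr_ge0// => s _; rewrite mulr_ge0 ?(ltW (dens_gt0 _ _ _))// sumr_ge0// => i _; rewrite sqr_ge0.
Qed.

Lemma risk_le (c : R) :
  (iter_int n (fun x => (sqr_gap x)%:E) <= (n`!%:R * c)%:E)%E ->
  (risk ts <= c%:E)%E.
Proof.
move=> h; have f0 : (0 : R) < n`!%:R by rewrite ltr0n fact_gt0.
rewrite /risk.
apply: (@le_trans _ _ ((n`!%:R^-1)%:E * (n`!%:R * c)%:E)%E); last first.
  by rewrite -EFinM mulKf// gt_eqF.
rewrite lee_wpmul2l// ?lee_fin ?invr_ge0//.
apply: le_trans h; apply: le_trans (iter_int_superadd_sum _ _ _) _.
  move=> s x; rewrite lee_fin mulr_ge0 ?(ltW (dens_gt0 _ _ _))// sumr_ge0// => i _.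
  exact: sqr_ge0.
rewrite le_eqVlt; apply/orP; left; apply/eqP; congr iter_int; apply/funext => x.
by rewrite sumEFin.
Qed.

(** Jensen around [postmean]; the factor 1 is the weight [b] of [prodsum_mse]. *)
Lemma sqr_gap_le x :
  sqr_gap x <= \sum_(s : 'S_n) \sum_(i < n) dens ts s x *
    ((ts (s i) - postmean ts (x i)) ^+ 2 * 1).
Proof.
rewrite /sqr_gap -mulr_sumr exchange_big /= mulr_suml.
apply: ler_sum => i _; rewrite thetaSE -sqrrN opprB.
apply: le_trans (thetaPI_sqr_dev_le _ _ _ _) _.
by apply: ler_sum => s _; rewrite mulr1.
Qed.

Lemma risk_le_dim : (risk ts <= n%:R%:E)%E.
Proof.
apply: risk_le.
have [||j|V Vle pV] := @prodsum_mse R n ts (fun=> 1) 1 => //.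
  by under eq_integral do rewrite mulr1; exact: integral_normal_sqr_le1.
apply: (@le_trans _ _ (V%:E)); last by rewrite lee_fin; rewrite mulr1 in Vle.
rewrite -(prodsum_iter_int pV); apply: le_iter_int => x; rewrite lee_fin.
  exact: sqr_gap_ge0.
exact: sqr_gap_le.
Qed.

(** A single coordinate [X_i] is all of [X], so the two estimators coincide. *)
Lemma risk_le0 : (n <= 1)%N -> (risk ts <= 0)%E.
Proof.
move=> n1; apply: risk_le; rewrite mulr0.
have z (i : 'I_n) : val i = 0%N.
  by apply/eqP; rewrite -leqn0 -ltnS (leq_trans (ltn_ord i)).
have eqi (i l : 'I_n) : l = i by apply: val_inj; rewrite !z.
have -> : (fun x => (sqr_gap x)%:E) = (fun=> 0%:E).
  apply/funext => x; congr EFin; rewrite /sqr_gap big1// => s _.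
  rewrite big1 ?mul0r// => i _.
  have de t : dens ts t x = normal_pdf (ts (t i)) 1 (x i).
    by rewrite /dens (big_pred1 i) => // l; rewrite (eqi i l) /= eqxx.
  rewrite /thetaS /thetaPI; under [X in _ - X / _]eq_bigr do rewrite de.
  under [X in _ - _ / X]eq_bigr do rewrite de.
  by rewrite subrr expr0n.
by rewrite (prodsum_iter_int (prodsum0 R n)).
Qed.

Lemma sqr_gap_decoupled (m : nat) (r : 'I_n -> 'I_m -> R) (v : 'I_m -> R) (l b : R) x :
  (forall j y, 0 <= r j y) -> (forall j, \sum_y r j y = 1) ->
  (forall j, \sum_y r j y * v y = ts j) ->
  (forall j y, r j y != 0 -> `|v y - ts j| <= 1) ->
  1 <= l -> expR l = n%:R ^+ 2 ->
  b = 2 * (2 * expR 3) * (12 * l) ->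
  sqr_gap x + (4 * b * n%:R) * (\sum_(s : 'S_n) dens ts s x) <=
  4 * b * (n`!%:R * \prod_(i < n) ((\sum_j phi j (x i)) / n%:R) +
    \sum_(s : 'S_n) \sum_(i < n) (\prod_(k < n | k != i) phi (s k) (x k)) *
     (\sum_(k < n | (i <= k)%N) overlap ts r (s i) (s k) (x i) / (n - i)%:R)) +
  \sum_(s : 'S_n) \sum_(i < n) dens ts s x *
    ((ts (s i) - postmean ts (x i)) ^+ 2 * far_weight ts (x i)).
Proof.
move=> r0 r1 rv rnear l1 el bE.
have b0 : 0 < b by rewrite bE !mulr_gt0 ?expR_gt0//; lra.
pose h (i : 'I_n) := thetaPI ts i x - postmean ts (x i).
(* [h i / (2 * b)] maximizes [lam * h i - b * lam ^+ 2], with value [h i ^+ 2 / (4 * b)], whence the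
   factor [4 * b]. At far points, where the sub-Gaussian bound may fail, 0 makes it trivial. *)
pose lam (i : 'I_n) := if far_weight ts (x i) <= 1 then h i / (2 * b) else 0.
have dec := @decoupling_pointwise R n ts m r v r0 r1 rv x lam b.
have b4 : 0 <= 4 * b by rewrite mulr_ge0// ltW.
have {}dec H := ler_wpM2l b4 (dec H).
set D := \sum_(s : 'S_n) dens ts s x in dec *.
have D0 : 0 < D := sum_dens_gt0 ts x.
apply: le_trans (lerD (dec _) (lexx _)); last first.
  move=> i; have [far|far] := lerP (far_weight ts (x i)) 1.
    by rewrite bE; exact: (good_mgf r0 r1 rv rnear i (lam i) l1 el far).
  rewrite /lam (lt_geF far) expr0n /= mulr0 expR0 mul1r.
  apply: ler_sum => j _; under eq_bigr do rewrite mul0r expR0 mulr1.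
  by rewrite -mulr_sumr r1 mulr1.
have -> : 4 * b * (D * (\sum_(i < n) (lam i * (thetaPI ts i x - postmean ts (x i)) - b * lam i ^+ 2) + n%:R)) =
  \sum_(i < n) 4 * b * (lam i * h i - b * lam i ^+ 2) * D + 4 * b * n%:R * D.
  by rewrite -mulr_suml -mulr_sumr; ring.
rewrite addrAC lerD2r exchange_big /= -big_split /=.
rewrite /sqr_gap -mulr_sumr -/D mulr_suml; apply: ler_sum => i _.
rewrite thetaSE -sqrrN opprB -/(h i) /lam.
have [far|far] := lerP (far_weight ts (x i)) 1.
  have -> : 4 * b * (h i / (2 * b) * h i - b * (h i / (2 * b)) ^+ 2) = h i ^+ 2.
    by field; rewrite gt_eqF.
  rewrite lerDl sumr_ge0// => s _; rewrite mulr_ge0 ?(ltW (dens_gt0 _ _ _))//.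
  by rewrite mulr_ge0 ?sqr_ge0 ?far_weight_ge0.
rewrite mul0r expr0n /= mulr0 subrr mulr0 mul0r add0r.
(* Here the weight exceeds 1, so the weighted squared error alone pays for this coordinate. *)
apply: le_trans (thetaPI_sqr_dev_le _ _ _ _) _.
apply: ler_sum => s _; rewrite ler_wpM2l ?(ltW (dens_gt0 _ _ _))//.
by rewrite -[leLHS]mulr1 ler_wpM2l ?sqr_ge0// ltW.
Qed.

Lemma risk_le_ln (mu : R) : (1 < n)%N -> 1 <= mu -> (forall j, `|ts j| <= mu) ->
  (risk ts <= ((384 * expR 3 * (18 * (expR (1 / 2) * Num.sqrt 2) + 6) + 64)
     * mu * ln n%:R ^+ 2)%:E)%E.
Proof.
move=> n1 mu1 tsmu; apply: risk_le.
have nR : (0 : R) < n%:R by rewrite ltr0n ltnW.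
have f0 : (0 : R) < n`!%:R by rewrite ltr0n fact_gt0.
set L := ln n%:R; have L2 : 1 / 2 <= L by exact: ln_nat_ge_half.
have [m [r [v [m6 r0 r1 rv rnear]]]] := unbiased_rounding mu1 tsmu.
set kap := expR (1 / 2) * Num.sqrt 2.
have k0 : 0 <= kap by rewrite mulr_ge0 ?expR_ge0 ?sqrtr_ge0.
have l1 : 1 <= 2 * L by lra.
have el : expR (2 * L) = n%:R ^+ 2.
  by rewrite expRM_natl lnK// posrE.
have T0 : 0 <= m%:R * kap by rewrite mulr_ge0.
have [V Vle pV] := prodsum_decoupling r0 r1 n1 T0 (trace_overlap r0 r1 rnear).
have [V' V'le pV'] := prodsum_mse (measurable_far_weight ts) (far_weight_ge0 ts) (far_mse ts).
pose b : R := 2 * (2 * expR 3) * (12 * (2 * L)).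
have e0 : (0 : R) < expR 3 by exact: expR_gt0.
have bE : b = 96 * expR 3 * L by rewrite /b; ring.
have b0 : 0 <= 4 * b by rewrite bE !mulr_ge0//; lra.
have pD : prodsum n (fun x => 4 * b * n%:R * (\sum_(s : 'S_n) dens ts s x)) (4 * b * n%:R * \sum_(s : 'S_n) 1).
  apply: prodsumZ; first by rewrite mulr_ge0.
  by apply: prodsum_sum => s _; exact: (prodsum_normal (fun i => ts (s i))).
have := iter_int_le_prodsum sqr_gap_ge0 pD (prodsumD (prodsumZ b0 pV) pV')
  (fun x => sqr_gap_decoupled x r0 r1 rv rnear l1 el erefl).
move=> /le_trans; apply; rewrite lee_fin.
have -> : \sum_(s : 'S_n) 1 = n`!%:R :> R by rewrite sumr_const card_Sn.
have V'e : V' <= n`!%:R * 16.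
  by apply: le_trans V'le _; rewrite [n%:R * _]mulrC divfK ?gt_eqF.
have Hn : \sum_(i < n) (n - i)%:R^-1 <= 1 + L :> R by apply: harmonic_le_ln; exact: ltnW.
(* The [n] on the right is cancelled by the [4 * b * n] term of [sqr_gap_decoupled]; only 2
   survives. *)
have nn : n%:R * (n%:R / n.-1%:R) <= n%:R + 2 :> R.
  have p1 : (1 : R) <= n.-1%:R by rewrite ler1n -ltnS prednK// ltnW.
  have ne : n%:R = n.-1%:R + 1 :> R by rewrite natr1 prednK// ltnW.
  rewrite mulrA ler_pdivrMr; last by lra.
  by rewrite ne; move: (n.-1%:R) p1 => q q1; nra.
apply: (@le_trans _ _ (n`!%:R * (4 * b * (1 + m%:R * kap * (1 + L) + 2) + 16))).
  have h1 : V <= n`!%:R * (1 + m%:R * kap * (1 + L) + (n%:R + 2)).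
    apply: le_trans Vle _; rewrite ler_wpM2l ?(ltW f0)//.
    by apply: lerD nn; rewrite lerD2l ler_wpM2l.
  have := ler_wpM2l b0 h1; move: V'e; lra.
rewrite ler_wpM2l ?(ltW f0)// bE.
(* Since [L >= 1 / 2] and [mu >= 1], one has [1 + L <= 3 * L], [3 <= 6 * mu * L] and
   [16 <= 64 * mu * L ^+ 2]; with [4 * 96 = 384] this gives the final constant. *)
have h1 : m%:R * kap * (1 + L) <= 6 * mu * kap * (3 * L).
  by apply: ler_pM => //; [lra|apply: ler_wpM2r|lra].
have h2 : 1 + m%:R * kap * (1 + L) + 2 <= mu * L * (18 * kap + 6) by nra.
have h3 : 0 <= 4 * (96 * expR 3 * L) by rewrite !mulr_ge0//; lra.
have h4 : 16 <= mu * L ^+ 2 * 64 by rewrite expr2; nra.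
have := ler_wpM2l h3 h2; lra.
Qed.

End Risk.

Theorem theorem6 (R : realType) :
  exists C : R, forall (n : nat) (mu : R) (ts : 'I_n -> R),
    1 <= mu -> (forall i, `|ts i| <= mu) ->
    (risk ts <= (Order.min (C * mu * (ln (n%:R)) ^+ 2) n%:R)%:E)%E.
Proof.
exists (384 * expR 3 * (18 * (expR (1 / 2) * Num.sqrt 2) + 6) + 64) => n mu ts mu1 tsmu.
rewrite /Order.min; case: ifP => _; last exact: risk_le_dim.
(* For [n = 1] the logarithm is 0, so the risk itself must vanish. *)
have [n1|n1] := ltnP 1 n; first exact: risk_le_ln.
apply: le_trans (risk_le0 _ n1) _; rewrite lee_fin mulr_ge0 ?sqr_ge0// mulr_ge0//; last by lra.
Qed.
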